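(* Let $\alpha>0$, let $A$ be an $n\times n$ nonsingular $M$-matrix with diagonal entries $a_1,\ldots,a_n$, and let $R=A^{-1}$. Let $X=(X_1,\ldots,X_n)$ be the $\alpha$-permanental random variable determined by $R$, let $Y=(a_1X_1,\ldots,a_nX_n)$, and let $Z=(Z_1,\ldots,Z_n)=Z_{\alpha,\overline B}$ be the associated $\mathbb{N}^n$-valued random variable. Let $\Phi$ be a positive real valued measurable function. Then $$E(\Phi(\|Y\|_{\ell^1}))=E\left(\Phi\left(\xi_{n\alpha+\|Z\|_{\ell^1},1}\right)\right).$$
   Context: A real matrix $A=\{a_{i,j}\}_{1\le i,j\le n}$ is a nonsingular $M$-matrix if $a_{i,j}\le 0$ for all $i\ne j$, $A$ is nonsingular, and all entries of $A^{-1}$ are nonnegative. $|M|$ denotes the determinant of a matrix $M$. Let $a_i=a_{i,i}$ be the diagonal entries of $A$ (they are positive), let $D_A=\mathrm{diag}(a_1,\ldots,a_n)$, and write $A=D_A-B$, so $B$ has nonnegative entries and zero diagonal. Set $\overline A=D_A^{-1}A=I-\overline B$ with $\overline B=D_A^{-1}B$. The $\alpha$-permanental random variable determined by $R$ is an $\mathbb{R}^n$-valued random variable $X$ (with nonnegative components) with Laplace transform $E(e^{-\sum_{i=1}^n s_iX_i})=|I+RS|^{-\alpha}$ for all $s_i\ge0$, where $S=\mathrm{diag}(s_1,\ldots,s_n)$; it exists for all $\alpha>0$ when $R^{-1}$ is a nonsingular $M$-matrix. For $\alpha>0$ the $\alpha$-permanent of an $n\times n$ matrix $M$ is $|M|_\alpha=\sum_{\pi}\alpha^{c(\pi)}M_{1,\pi(1)}M_{2,\pi(2)}\cdots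 M_{n,\pi(n)}$, where the sum is over all permutations $\pi$ of $\{1,\ldots,n\}$ and $c(\pi)$ is the number of cycles of $\pi$. $\mathbb{N}=\{0,1,2,\ldots\}$. For ${\bf k}=(k_1,\ldots,k_n)\in\mathbb{N}^n$ put $|{\bf k}|=\sum_l k_l$, and for $1\le m\le|{\bf k}|$ let $i_m=j$ where $j$ is determined by $\sum_{l=1}^{j-1}k_l<m\le\sum_{l=1}^{j}k_l$. For an $n\times n$ matrix $C=\{c_{i,j}\}$, $C({\bf k})$ is the $|{\bf k}|\times|{\bf k}|$ matrix with $(p,q)$ entry $c_{i_p,i_q}$; by convention $|C({\bf 0})|_\alpha=1$. $Z=Z_{\alpha,\overline B}$ is an $\mathbb{N}^n$-valued random variable with distribution $P(Z=(k_1,\ldots,k_n))=|\overline A|^{\alpha}\,\dfrac{|\overline B({\bf k})|_\alpha}{\prod_{i=1}^n k_i!}$ (these probabilities sum to 1). $\xi_{u,v}$ ($u,v>0$) denotes a gamma random variable with density $v^{u}x^{u-1}e^{-vx}/\Gamma(u)$ for $x>0$ and $0$ for $x\le0$. All these gamma variables are taken independent of $Z$, so $\xi_{n\alpha+\|Z\|_{\ell^1},1}$ is the random variable which, conditionally on $\|Z\|_{\ell^1}=j$, has the law of $\xi_{n\alpha+j,1}$. For a vector, $\|x\|_{\ell^1}=\sum_i|x_i|$. *)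

(* Defs.v *)
From HB Require Import structures.
From mathcomp Require Import all_boot all_order all_algebra perm.
From mathcomp Require Import all_classical all_reals all_analysis.

Set Implicit Arguments.
Unset Strict Implicit.
Unset Printing Implicit Defensive.

Import Order.TTheory GRing.Theory Num.Theory.
Import numFieldNormedType.Exports.

Local Open Scope classical_set_scope.
Local Open Scope ring_scope.

Definition nonsingular_M_matrix (R : realType) (n : nat) (A : 'M[R]_n) : Prop :=
  [/\ forall i j, i != j -> A i j <= 0,
      A \in unitmx &
      forall i j, 0 <= invmx A i j].

Definition diag_part (R : realType) (n : nat) (A : 'M[R]_n) : 'M[R]_n :=
  diag_mx (\row_i A i i).

Definition offdiag_part (R : realType) (n : nat) (A : 'M[R]_n) : 'M[R]_n :=
  diag_part A - A.

Definition Abar (R : realType) (n : nat) (A : 'M[R]_n) : 'M[R]_n :=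
  invmx (diag_part A) *m A.

Definition Bbar (R : realType) (n : nat) (A : 'M[R]_n) : 'M[R]_n :=
  invmx (diag_part A) *m offdiag_part A.

(* [porbits s] is the set of cycles of [s], fixed points included. For [m = 0]
   the sum has one term and the value is 1. *)
Definition alpha_permanent (R : realType) (m : nat) (alpha : R) (M : 'M[R]_m) : R :=
  \sum_(s : 'S_m) alpha ^+ #|porbits s| * \prod_(i < m) M i (s i).

(* [tagnat.sig1 p] is the index of the block containing position [p] when
   [0, \sum_l k l) is cut into consecutive blocks of lengths k 0, k 1, ...; see
   [sig1P]. *)
Definition blowup (R : realType) (n : nat) (C : 'M[R]_n) (k : 'I_n -> nat)
    : 'M[R]_(\sum_(l < n) k l)%N :=
  \matrix_(p, q) C (tagnat.sig1 p) (tagnat.sig1 q).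

(* Positions are counted from 0, so the m-th index (counted from 1) sits at
   p = m - 1 and  \sum_(l < j) k l < m <= \sum_(l <= j) k l  becomes the
   right-hand side below. *)
Lemma sig1P (n : nat) (k : 'I_n -> nat) (p : 'I_(\sum_(l < n) k l)) (j : 'I_n) :
  tagnat.sig1 p = j <->
  (\sum_(l < n | (l < j)%N) k l <= p < \sum_(l < n | (l <= j)%N) k l)%N.
Proof.
have split (i : 'I_n) : (\sum_(l < n | (l <= i)%N) k l =
    \sum_(l < n | (l < i)%N) k l + k i)%N.
  rewrite (bigD1 i) //= addnC; congr (_ + _)%N.
  by apply: eq_bigl => l; rewrite andbC -ltn_neqAle.
have mono (i i' : 'I_n) : (i < i')%N ->
    (\sum_(l < n | (l <= i)%N) k l <= \sum_(l < n | (l < i')%N) k l)%N.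
  move=> ii'; rewrite [leqRHS](bigID (fun l : 'I_n => (l <= i)%N)) /=.
  apply: leq_trans (leq_addr _ _); apply: eq_leq; apply: eq_bigl => l.
  by case: (leqP l i) => [li|]; rewrite ?andbF // (leq_ltn_trans li ii').
set i := tagnat.sig1 p.
have Hi : (\sum_(l < n | (l < i)%N) k l <= p < \sum_(l < n | (l <= i)%N) k l)%N.
  have -> : (p : nat) =
      (\sum_(l < n | (l < i)%N) k l + tagnat.sig2 p)%N.
    by rewrite -[in LHS](tagnat.sig2K p) /tagnat.Rank tagnat.rankEsum.
  by rewrite split leq_addr ltn_add2l ltn_ord.
split=> [<- //|/andP[H1 H2]]; case/andP: Hi => H3 H4.
case: (ltngtP i j) => [ij|ji|/val_inj //].
- by have := leq_trans (leq_trans H4 (mono _ _ ij)) H1; rewrite ltnn.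
- by have := leq_trans (leq_trans H2 (mono _ _ ji)) H3; rewrite ltnn.
Qed.

Definition l1norm (R : realType) (n : nat) (x : 'I_n -> R) : R :=
  \sum_(i < n) `|x i|.

Definition permanental (d : measure_display) (T : measurableType d)
    (R : realType) (P : probability T R) (n : nat) (alpha : R) (K : 'M[R]_n)
    (X : 'I_n -> {RV P >-> R}) : Prop :=
  (forall i, {ae P, forall w, 0 <= X i w}) /\
  (forall s : 'I_n -> R, (forall i, 0 <= s i) ->
    ('E_P[(fun w => expR (- \sum_(i < n) s i * X i w))%R])%E =
    ((\det (1%:M + K *m diag_mx (\row_i s i))) `^ (- alpha))%:E).

Definition Z_law (d : measure_display) (T : measurableType d)
    (R : realType) (P : probability T R) (n : nat) (alpha : R) (A : 'M[R]_n)
    (Z : 'I_n -> {RV P >-> nat}) : Prop :=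
  forall k : 'I_n -> nat,
    P [set w | forall i, Z i w = k i] =
    ((\det (Abar A)) `^ alpha * alpha_permanent alpha (blowup (Bbar A) k)
       / \prod_(i < n) ((k i)`!)%:R)%:E.

Definition Gamma (R : realType) (u : R) : R :=
  Rintegral lebesgue_measure `]0, +oo[ (fun x : R => x `^ (u - 1) * expR (- x)).

Definition gamma_pdf (R : realType) (u v x : R) : R :=
  if 0 < x then v `^ u * x `^ (u - 1) * expR (- (v * x)) / Gamma u else 0.

Definition gamma_law (R : realType) (u v : R) (S : set R) : \bar R :=
  (\int[lebesgue_measure]_(x in S) (gamma_pdf u v x)%:E)%E.

(* Conditionally on N = j, W has the gamma law of parameters (r + j, 1): this is
   what is meant by W = xi_{r + N, 1}. *)
Definition gamma_mixture (d : measure_display) (T : measurableType d)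
    (R : realType) (P : probability T R) (r : R) (N : T -> nat)
    (W : {RV P >-> R}) : Prop :=
  forall (j : nat) (S : set R), measurable S ->
    (P ([set w | N w = j] `&` W @^-1` S) =
     P [set w | N w = j] * gamma_law (r + j%:R)%R 1%R S)%E.

(* In particular one may take gamma variables xi_{r + j, 1}, each independent of
   N, and set W = xi_{r + N, 1}. *)
Lemma gamma_mixture_indep (d : measure_display) (T : measurableType d)
    (R : realType) (P : probability T R) (r : R) (N : T -> nat)
    (xi : nat -> {RV P >-> R}) (W : {RV P >-> R}) :
  (forall j S, measurable S -> P (xi j @^-1` S) = gamma_law (r + j%:R) 1 S) ->
  (forall j i S, measurable S ->
    (P ([set w | N w = i] `&` xi j @^-1` S) =
     P [set w | N w = i] * P (xi j @^-1` S))%E) ->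
  (forall w, W w = xi (N w) w) ->
  gamma_mixture r N W.
Proof.
move=> lawxi indep WE j S mS; rewrite -lawxi // -indep //; congr (P _).
by apply/seteqP; split=> w /= [Nw]; rewrite WE Nw.
Qed.

(* Main.v *)
Require Import Defs.
From HB Require Import structures.
From mathcomp Require Import all_boot all_order all_algebra perm.
From mathcomp Require Import all_classical all_reals all_analysis.
From mathcomp Require Import measurable_realfun ring lra.

Set Implicit Arguments.
Unset Strict Implicit.
Unset Printing Implicit Defensive.

Import Order.TTheory GRing.Theory Num.Theory.
Import numFieldNormedType.Exports.

Local Open Scope classical_set_scope.
Local Open Scope ring_scope.

(** Both sides are integrals of Phi against a law on the half line, so it is
    enough to show that the two laws have the same Laplace transform; call
    [B] the matrix [Bbar A] and write t = 1 / (1 + s).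

    Since [1 + s A^-1 D_A] equals, up to the factor [Abar^-1], the matrix
    (1 + s) (1 - t B), the weighted sum of the permanental variables has
    transform
      |Abar|^alpha (1 + s)^(- n alpha) |1 - t B|^(- alpha)
    ([det_permanental], [laplace_weighted_sum]).  The gamma mixture has transform
      sum_j P(|Z| = j) (1 + s)^(- (n alpha + j))
    ([laplace_gamma_mixture]), because changing the unit of length in the gamma
    density turns exp(- s x) into a power of 1 + s.  Hence the theorem is the
    identity
      sum_j c_j t^j = |1 - t B|^(- alpha)   for 0 <= t <= 1,
    where P(|Z| = j) = |Abar|^alpha c_j.

    Grouping the words f : [1..j] -> [1..n] by their content k gives
    c_j = (1 / j!) sum_f |B_f|_alpha, with B_f the matrix of the B(f p, f q)
    ([sum_blowup]).  Removing one point from its cycle yields the recursion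
      (j + 1) c_(j+1) = alpha sum_(i <= j) tr(B^(i+1)) c_(j-i)
    ([words_coefS]), which formally is F' = alpha P F for the series F of the
    c_j and the series P of the traces, while Jacobi's formula says
    q' = - P q for q(t) = |1 - t B|.

    The differential equation is only used as an inequality between polynomials.
    All coefficients are nonnegative, so a partial sum F_N of F satisfies
    F_N' <= alpha P_N F_N, and P_N q <= - q' for 0 <= t < 1 because the adjugate of
    1 - t B is nonnegative there, A being an M-matrix.  Therefore F_N q^alpha is
    nonincreasing on [0, 1], and so is F q^alpha.  This limit is 1 at t = 0, and it
    is 1 at t = 1 because the law of Z has total mass 1; it is thus constant
    ([words_series]).

    Finally a law on the half line is determined by the integrals of the
    exp(- m x), m natural: the polynomials (1 - y^k)^(k e^(k b)) in y = exp(- x)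
    converge to the indicator of x > b at every x >= 0, the point b included
    ([laplace_unique]). *)

(** * Cycles of a permutation with one more point *)

Lemma porbit_lift_perm_fixed m (q : 'I_m.+1) (s : 'S_m) :
  porbit (lift_perm q q s) q = [set q]%SET.
Proof.
apply/setP => x; rewrite inE; apply/porbitP/eqP => [[i ->]|->]; last first.
  by exists 0%N; rewrite expg0 perm1.
by elim: i => [|i IH]; rewrite ?expg0 ?perm1// expgSr permM IH lift_perm_id.
Qed.

Lemma expg_lift_perm m (q : 'I_m.+1) (s : 'S_m) (i : nat) (k : 'I_m) :
  (lift_perm q q s ^+ i)%g (lift q k) = lift q ((s ^+ i)%g k).
Proof.
elim: i => [|i IH]; first by rewrite !expg0 !perm1.
by rewrite !expgSr !permM IH lift_perm_lift.
Qed.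

Lemma porbit_lift_perm_lift m (q : 'I_m.+1) (s : 'S_m) (k : 'I_m) :
  porbit (lift_perm q q s) (lift q k) = (lift q @: porbit s k)%SET.
Proof.
apply/setP => x; apply/porbitP/imsetP => [[i ->]|[y /porbitP[i ->] ->]].
  by exists ((s ^+ i)%g k); [exact: mem_porbit | exact: expg_lift_perm].
by exists i; rewrite expg_lift_perm.
Qed.

(** [lift_perm q q s] fixes q and acts as s on the other points, so its only new
    cycle is the singleton of q. *)
Lemma card_porbits_lift_perm m (q : 'I_m.+1) (s : 'S_m) :
  #|porbits (lift_perm q q s)| = #|porbits s|.+1.
Proof.
have -> : porbits (lift_perm q q s) =
    ([set q] |: [set lift q @: (Y : {set 'I_m}) | Y in porbits s])%SET.
  apply/setP => Y; rewrite !inE; apply/imsetP/orP => [[x _ ->]|[/eqP ->|]].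
  - case: (unliftP q x) => [k ->|->]; last first.
      by left; rewrite porbit_lift_perm_fixed.
    right; apply/imsetP; exists (porbit s k); first exact: imset_f.
    by rewrite porbit_lift_perm_lift.
  - by exists q => //; rewrite porbit_lift_perm_fixed.
  - case/imsetP => _ /imsetP[k _ ->] ->; exists (lift q k) => //.
    by rewrite porbit_lift_perm_lift.
rewrite cardsU1 card_imset; last exact/imset_inj/lift_inj.
suff -> : [set q]%SET \notin [set lift q @: (Y : {set 'I_m}) | Y in porbits s]%SET.
  by rewrite add1n.
apply/imsetP => -[Y _ /setP/(_ q)]; rewrite inE eqxx => /esym/imsetP[k _].
by move/eqP; apply/negP; exact: neq_lift.
Qed.

(** For [x.1 = q] the point q is added to [x.2] as a fixed point; otherwise q is
    inserted in the cycle of [x.2] through [x.1], right after [x.1]. *)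
Definition insert_perm m (q : 'I_m.+1) (x : 'I_m.+1 * 'S_m) : 'S_m.+1 :=
  (tperm q x.1 * lift_perm q q x.2)%g.

Lemma insert_perm_bij m (q : 'I_m.+1) : bijective (insert_perm q).
Proof.
apply: inj_card_bij; last by rewrite card_prod !card_Sn card_ord -factS.
move=> [a s] [b t] /= E.
(* The first component is recovered as the preimage of q. *)
have image_q x u : insert_perm q (x, u) x = q.
  by rewrite permM /= tpermR lift_perm_id.
have ab : a = b.
  apply: (@perm_inj _ (insert_perm q (a, s))).
  by rewrite image_q E image_q.
rewrite -ab in E *; congr (_, _); move/mulgI: E => /= /permP E.
apply/permP => k; apply: (@lift_inj _ q).
by have := E (lift q k); rewrite !lift_perm_lift.
Qed.

Lemma card_porbits_insert m (q : 'I_m.+1) (x : 'I_m.+1 * 'S_m) :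
  #|porbits (insert_perm q x)| = (#|porbits x.2| + (q == x.1))%N.
Proof.
case: x => a s; rewrite /insert_perm /=.
have := porbits_mul_tperm (lift_perm q q s) q a.
rewrite /= card_porbits_lift_perm.
have [->|qa] := eqVneq q a.
  by rewrite porbit_id /= !addn0 addn1.
suff -> : q \notin porbit (lift_perm q q s) a.
  by rewrite addn0 /= !addnS addn0 => -[] /= /eqP; rewrite ?addn0 ?addn1 ?eqSS => /eqP ->.
by rewrite porbit_sym porbit_lift_perm_fixed inE eq_sym.
Qed.

(** * Expansion of an alpha-permanent and the recursion for sums over words *)

Section Recursion.
Context (R : realType) (alpha : R).

(** The permutations are sorted by the predecessor of q.  If q is fixed it forms a
    cycle of its own and contributes a factor alpha.  If the predecessor is
    [lift q i], short-circuiting q keeps the number of cycles and merges two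
    entries of M into one entry of the row i. *)
Lemma alpha_permanent_insert m (M : 'M[R]_m.+1) (q : 'I_m.+1) :
  alpha_permanent alpha M =
  alpha * M q q * alpha_permanent alpha (\matrix_(j, k) M (lift q j) (lift q k))
  + \sum_(i < m) alpha_permanent alpha
     (\matrix_(j, k) if j == i then M (lift q i) q * M q (lift q k)
                     else M (lift q j) (lift q k)).
Proof.
rewrite {1}/alpha_permanent (reindex (insert_perm q)) /=; last first.
  exact/onW_bij/insert_perm_bij.
rewrite -(pair_bigA _ (fun a s => alpha ^+ #|porbits (insert_perm q (a, s))| *
   \prod_(i < m.+1) M i (insert_perm q (a, s) i))) /=.
rewrite (bigD1_ord q) //=; congr (_ + _).
  rewrite mulr_sumr; apply: eq_bigr => s _.
  rewrite card_porbits_insert /= eqxx addn1 exprS -!mulrA; congr (_ * _).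
  rewrite [RHS]mulrCA; congr (_ * _).
  rewrite (bigD1_ord q) //= /insert_perm /= tperm1 mul1g lift_perm_id; congr (_ * _).
  by apply: eq_bigr => i _; rewrite lift_perm_lift mxE.
apply: eq_bigr => i _; apply: eq_bigr => s _.
rewrite card_porbits_insert /= (negbTE (neq_lift _ _)) addn0; congr (_ * _).
rewrite (bigD1_ord q) //= [in LHS](bigD1 i) //= [in RHS](bigD1 i) //=.
rewrite /insert_perm /= !permM tpermL tpermR lift_perm_lift lift_perm_id.
rewrite mxE eqxx [in RHS](mulrC (M _ q)) -!mulrA; congr (_ * (_ * _)).
apply: eq_bigr => j ji; rewrite mxE (negbTE ji) permM tpermD ?lift_perm_lift //.
- exact: neq_lift.
- by rewrite (inj_eq lift_inj) eq_sym.
Qed.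

Context (n : nat) (B : 'M[R]_n).

Definition word_permanent m (f : 'I_m -> 'I_n) : R :=
  alpha_permanent alpha (\matrix_(p, r) B (f p) (f r)).

Definition words_sum m : R := \sum_(f : {ffun 'I_m -> 'I_n}) word_permanent f.

(** The letter leaving position q is weighted by M instead of B.  Contracting the
    position q turns M into [B *m M], so this family of sums is closed under the
    expansion of the alpha-permanent, which [words_sum] alone is not. *)
Definition marked_sum m (M : 'M[R]_n) (q : 'I_m) : R :=
  \sum_(f : {ffun 'I_m -> 'I_n})
    alpha_permanent alpha (\matrix_(p, r) (if p == q then M else B) (f p) (f r)).

Lemma marked_sum_self m (q : 'I_m) : marked_sum B q = words_sum m.
Proof.
apply: eq_bigr => f _; congr alpha_permanent; apply/matrixP => p r.
by rewrite !mxE if_same.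
Qed.

Definition insert_letter m (q : 'I_m.+1) (x : 'I_n * {ffun 'I_m -> 'I_n}) :
    {ffun 'I_m.+1 -> 'I_n} :=
  [ffun p => if unlift q p is Some k then x.2 k else x.1].

Lemma insert_letter_lift m (q : 'I_m.+1) x k : insert_letter q x (lift q k) = x.2 k.
Proof. by rewrite ffunE liftK. Qed.

Lemma insert_letter_at m (q : 'I_m.+1) x : insert_letter q x q = x.1.
Proof. by rewrite ffunE unlift_none. Qed.

Lemma insert_letter_bij m (q : 'I_m.+1) : bijective (insert_letter q).
Proof.
exists (fun f : {ffun 'I_m.+1 -> 'I_n} => (f q, [ffun k => f (lift q k)])).
  move=> [a g]; rewrite insert_letter_at; congr (_, _); apply/ffunP => k.
  by rewrite ffunE insert_letter_lift.
by move=> f; apply/ffunP => p; rewrite ffunE /=; case: unliftP => [k|] -> //; rewrite ffunE.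
Qed.

Lemma alpha_permanent_row_sum m (I : finType) (M : 'M[R]_m) (i : 'I_m)
    (v : I -> 'I_m -> R) :
  alpha_permanent alpha (\matrix_(j, k) if j == i then \sum_a v a k else M j k) =
  \sum_a alpha_permanent alpha (\matrix_(j, k) if j == i then v a k else M j k).
Proof.
rewrite /alpha_permanent [RHS]exchange_big /=; apply: eq_bigr => s _.
rewrite -mulr_sumr; congr (_ * _); rewrite [LHS](bigD1 i) //= mxE eqxx /= mulr_suml.
apply: eq_bigr => a _; rewrite [RHS](bigD1 i) //= mxE eqxx; congr (_ * _).
by apply: eq_bigr => j ji; rewrite !mxE (negbTE ji).
Qed.

(** The expansion of the alpha-permanent at q, summed over words: the sum over the
    letter at q produces a trace when q is fixed and a matrix product when q is
    contracted into its predecessor. *)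
Lemma marked_sumS m (M : 'M[R]_n) (q : 'I_m.+1) :
  marked_sum M q =
  alpha * \tr M * words_sum m + \sum_(i < m) marked_sum (B *m M) i.
Proof.
rewrite /marked_sum (reindex (insert_letter q)) /=; last first.
  exact/onW_bij/insert_letter_bij.
rewrite -(pair_bigA _ (fun a g => alpha_permanent alpha (\matrix_(p, r)
   (if p == q then M else B) (insert_letter q (a, g) p) (insert_letter q (a, g) r)))) /=.
under eq_bigr => a _ do under eq_bigr => g _ do rewrite (alpha_permanent_insert _ q).
under eq_bigr => a _ do rewrite big_split /=.
rewrite big_split /=; congr (_ + _).
  rewrite /mxtrace [X in _ = X * _]mulr_sumr [RHS]mulr_suml; apply: eq_bigr => a _.
  rewrite [RHS]mulr_sumr; apply: eq_bigr => g _; rewrite mxE eqxx insert_letter_at.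
  congr (_ * alpha_permanent _ _); apply/matrixP => j k; rewrite !mxE.
  by rewrite eq_sym (negbTE (neq_lift _ _)) !insert_letter_lift.
rewrite exchange_big /= [RHS]exchange_big /=; apply: eq_bigr => g _.
rewrite exchange_big /=; apply: eq_bigr => i _.
have -> : (\matrix_(p, r) (if p == i then B *m M else B) (g p) (g r)) =
    \matrix_(j, k) if j == i then \sum_a B (g i) a * M a (g k)
                   else (\matrix_(p, r) B (g p) (g r)) j k.
  by apply/matrixP => j k; rewrite !mxE; case: eqP => [->|//]; rewrite mxE.
rewrite alpha_permanent_row_sum; apply: eq_bigr => a _; congr alpha_permanent.
apply/matrixP => j k; rewrite !mxE eqxx !insert_letter_lift !insert_letter_at /=.
by rewrite ![lift q _ == q]eq_sym !(negbTE (neq_lift _ _)).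
Qed.

Lemma marked_sumE m (M : 'M[R]_n) (q : 'I_m.+1) :
  marked_sum M q =
  \sum_(i < m.+1) alpha * \tr (B ^+ i *m M) * (m ^_ i)%:R * words_sum (m - i).
Proof.
elim: m M q => [|m IH] M q.
  rewrite marked_sumS big_ord0 addr0 big_ord_recl big_ord0 addr0 /= expr0 mul1mx.
  by rewrite ffactn0 mulr1 subn0.
rewrite marked_sumS [RHS]big_ord_recl /= expr0 mul1mx ffactn0 mulr1 subn0; congr (_ + _).
under eq_bigr do rewrite IH.
rewrite sumr_const card_ord -sumrMnl; apply: eq_bigr => i _.
rewrite /bump /= add1n subSS ffactnS /= natrM exprSr -mulmxE -mulmxA.
rewrite -[LHS]mulr_natl; ring.
Qed.

(** For the matrices B of [words_series], this is the coefficient of t^m in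
    |1 - t B|^(- alpha). *)
Definition words_coef m : R := words_sum m / (m`!)%:R.

Lemma words_coef0 : words_coef 0 = 1.
Proof.
rewrite /words_coef /words_sum (eq_bigr (fun=> 1)); last first.
  move=> f _; rewrite /word_permanent /alpha_permanent (eq_bigr (fun=> 1)).
    by rewrite sumr_const card_Sn mulr1n.
  move=> s _; rewrite big_ord0 mulr1; suff -> : porbits s = finset.set0 by rewrite cards0.
  by apply/setP => Y; rewrite inE; apply/negP => /imsetP[[]].
by rewrite sumr_const card_ffun !card_ord expn0 mulr1n divr1.
Qed.

(** Newton's recursion for exp(alpha sum_m tr(B^m) t^m / m). *)
Lemma words_coefS m : m.+1%:R * words_coef m.+1 =
  \sum_(i < m.+1) alpha * \tr (B ^+ i.+1) * words_coef (m - i).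
Proof.
transitivity (words_sum m.+1 / (m`!)%:R).
  rewrite /words_coef factS natrM; field.
  by rewrite nat1r !pnatr_eq0 -!lt0n fact_gt0.
rewrite -(marked_sum_self ord0) marked_sumE mulr_suml; apply: eq_bigr => i _.
have im : (i <= m)%N by rewrite -ltnS.
have -> : (m`!)%:R = (m ^_ i)%:R * ((m - i)`!)%:R :> R by rewrite -natrM ffact_fact.
rewrite mulmxE -exprSr; rewrite /words_coef; field.
by rewrite !pnatr_eq0 -!lt0n fact_gt0 ffact_gt0.
Qed.

End Recursion.

(** * Words with a given content *)

Lemma porbit_conj m (t s : 'S_m) x :
  porbit (t ^ s)%g (s x) = (s @: porbit t x)%SET.
Proof.
apply/setP => y; apply/porbitP/imsetP => [[i ->]|[_ /porbitP[i ->] ->]].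
  by exists ((t ^+ i)%g x); [exact: mem_porbit | rewrite -conjXg permJ].
by exists i; rewrite -conjXg permJ.
Qed.

Lemma card_porbits_conj m (t s : 'S_m) : #|porbits (t ^ s)%g| = #|porbits t|.
Proof.
have -> : porbits (t ^ s)%g = [set s @: (Y : {set 'I_m}) | Y in porbits t]%SET.
  apply/setP => Y; apply/imsetP/imsetP => [[x _ ->]|[_ /imsetP[x _ ->] ->]].
    exists (porbit t ((s^-1)%g x)); first exact: imset_f.
    by rewrite -porbit_conj permKV.
  by exists (s x); rewrite ?porbit_conj.
by rewrite card_imset //; exact/imset_inj/perm_inj.
Qed.

Section Words.
Context (R : realType) (alpha : R) (n : nat).
Implicit Types (B : 'M[R]_n).

Lemma word_permanent_perm B m (f : 'I_m -> 'I_n) (s : 'S_m) :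
  word_permanent alpha B (f \o s) = word_permanent alpha B f.
Proof.
rewrite /word_permanent /alpha_permanent.
rewrite [RHS](reindex_inj (@conjg_inj _ s)) /=; apply: eq_bigr => t _.
rewrite card_porbits_conj; congr (_ * _).
rewrite [RHS](reindex_inj (@perm_inj _ s)) /=; apply: eq_bigr => p _.
by rewrite !mxE permJ.
Qed.

Definition content m (f : 'I_m -> 'I_n) (i : 'I_n) : nat := (\sum_(p < m) (f p == i))%N.

Lemma sum_content m (f : 'I_m -> 'I_n) : (\sum_(i < n) content f i = m)%N.
Proof.
rewrite exchange_big /= (eq_bigr (fun=> 1%N)) ?sum1_card ?card_ord // => p _.
by rewrite (bigD1 (f p)) //= eqxx big1 // => i /negbTE; rewrite eq_sym => ->.
Qed.

(** Words with the same content differ by a permutation of their positions, which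
    conjugates the permutations in the alpha-permanent. *)
Lemma word_permanent_content B m m' (f : 'I_m -> 'I_n) (g : 'I_m' -> 'I_n) :
  content f =1 content g ->
  word_permanent alpha B f = word_permanent alpha B g.
Proof.
move=> fg; have mm' : m = m'.
  by rewrite -(sum_content f) -(sum_content g); apply: eq_bigr => i _; exact: fg.
case: _ / mm' in g fg *.
have /tuple_permP[s fs] : perm_eq [tuple f p | p < m] [tuple g p | p < m].
  apply/seq.permP => a; rewrite /= !count_map.
  have count_content (h : 'I_m -> 'I_n) : count (preim h a) (enum 'I_m) =
      (\sum_(i < n) a i * content h i)%N.
    under [RHS]eq_bigr do rewrite big_distrr /=.
    rewrite exchange_big /= -sum1_count big_enum_cond /= big_mkcond /=.
    apply: eq_bigr => p _; rewrite (bigD1 (h p)) //= eqxx muln1 big1 ?addn0 //.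
    by move=> i /negbTE; rewrite eq_sym => ->; rewrite muln0.
  rewrite -!enumT -[LHS]/(count (preim f a) (enum 'I_m)).
  rewrite -[RHS]/(count (preim g a) (enum 'I_m)).
  by rewrite !count_content; apply: eq_bigr => i _; rewrite fg.
rewrite -(word_permanent_perm B g s); congr alpha_permanent.
suff E p : f p = g (s p) by apply/matrixP => p r; rewrite !mxE /= !E.
have /(congr1 (fun t => tnth t p)) : [tuple f p | p < m] =
   [tuple tnth [tuple g p | p < m] (s i) | i < m] by exact/val_inj.
by rewrite !tnth_mktuple.
Qed.

Lemma content_sig1 (k : 'I_n -> nat) : content (@tagnat.sig1 n k) =1 k.
Proof.
move=> i; rewrite /content (reindex _ tagnat.rank_bij_on) /=.
rewrite (eq_bigr (fun x => nat_of_bool (tag x == i))); last first.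
  by move=> x _; rewrite /tagnat.sig1 tagnat.rankK.
rewrite -(sig_big_dep xpredT (fun _ _ => true)
  (fun (a : 'I_n) (b : 'I_(k a)) => nat_of_bool (a == i))) /=.
rewrite (bigD1 i) //= [X in (_ + X)%N]big1 ?addn0.
  rewrite (eq_bigr (fun=> 1%N)) ?sum1_card ?card_ord // => j _.
  by rewrite eqxx.
by move=> a /negbTE ai; rewrite big1 // => j _; rewrite ai.
Qed.

Lemma content_insert m (a : 'I_n) (g : {ffun 'I_m -> 'I_n}) i :
  content (insert_letter ord0 (a, g)) i = ((a == i) + content g i)%N.
Proof.
rewrite /content (bigD1_ord ord0) //= insert_letter_at; congr (_ + _)%N.
by apply: eq_bigr => p _; rewrite insert_letter_lift.
Qed.

(** The multinomial coefficient, multiplied out.  The induction splits off the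
    first letter a of the word; lowering k at a divides the product of the
    factorials by k a, and the k a add up to the length. *)
Lemma card_words m (k : 'I_n -> nat) : (\sum_(i < n) k i = m)%N ->
  ((\sum_(f : {ffun 'I_m -> 'I_n}) [forall i, content f i == k i]) *
    \prod_(i < n) (k i)`! = m`!)%N.
Proof.
elim: m k => [|m IH] k km.
  have k0 i : k i = 0%N.
    by apply/eqP; move/eqP: km; rewrite sum_nat_eq0 => /forallP/(_ i).
  rewrite (eq_bigr (fun=> 1%N)); last first.
    by move=> f _; apply/eqP; rewrite eqb1; apply/forallP => i; rewrite k0 /content big_ord0.
  rewrite sum1_card card_ffun !card_ord expn0 big1 // => i _.
  by rewrite k0.
rewrite (reindex (insert_letter ord0)) /=; last exact/onW_bij/insert_letter_bij.
rewrite -(pair_bigA _ (fun a g =>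
  [forall i, content (insert_letter ord0 (a, g)) i == k i] : nat)) /=.
have -> : (m.+1)`! = (\sum_(i < n) k i * m`!)%N by rewrite -big_distrl /= km factS.
rewrite big_distrl /=; apply: eq_bigr => a _.
have [ka0|] := posnP (k a).
  rewrite ka0 mul0n big1 // => g _; apply/eqP; rewrite eqb0.
  by apply/negP => /forallP/(_ a); rewrite content_insert eqxx ka0.
case ka: (k a) => [//|c] _.
pose k' i := (k i - (a == i))%N.
have kk' i : k i = ((a == i) + k' i)%N.
  by rewrite /k'; case: eqP => [<-|_]; rewrite ?ka ?subn0 //= add1n subn1.
have k'm : (\sum_(i < n) k' i = m)%N.
  apply: (@addnI 1); rewrite [RHS]add1n -km.
  under [RHS]eq_bigr do rewrite kk'.
  rewrite big_split /=; congr (_ + _)%N.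
  by rewrite (bigD1 a) //= eqxx big1 // => i /negbTE; rewrite eq_sym => ->.
rewrite -(IH k' k'm) mulnCA; congr (_ * _)%N.
  apply: eq_bigr => g _; congr (nat_of_bool _).
  by apply/eq_forallb => i; rewrite content_insert kk' eqn_add2l.
rewrite (bigD1 a) //= [in RHS](bigD1 a) //= mulnA; congr (_ * _)%N.
  by rewrite ka /k' eqxx ka subn1 factS.
by apply: eq_bigr => i; rewrite /k' eq_sym => /negbTE ->; rewrite subn0.
Qed.

(** The blown-up matrix at k is the matrix of the sorted word of content k, and
    each of the m! / prod k! words of that content has the same alpha-permanent. *)
Lemma sum_blowup B m :
  \sum_(k : {ffun 'I_n -> 'I_m.+1} | (\sum_(i < n) k i == m)%N)
    alpha_permanent alpha (blowup B (fun i => k i : nat)) / \prod_(i < n) ((k i)`!)%:R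
  = words_coef alpha B m.
Proof.
pose c (f : {ffun 'I_m -> 'I_n}) : {ffun 'I_n -> 'I_m.+1} := [ffun i => inord (content f i)].
have cE f i : c f i = content f i :> nat.
  rewrite ffunE inordK // ltnS; apply: leq_trans (eq_leq (sum_content f)).
  by rewrite (bigD1 i) //= leq_addr.
rewrite /words_coef /words_sum
  (partition_big c (fun k => (\sum_(i < n) k i == m)%N)) /=; last first.
  move=> f _; apply/eqP; apply: etrans (sum_content f).
  by apply: eq_bigr => i _; rewrite cE.
rewrite mulr_suml; apply: eq_bigr => k /eqP km.
rewrite [in RHS]
  (eq_bigr (fun=> alpha_permanent alpha (blowup B (fun i => k i : nat)))); last first.
  move=> f /eqP ck.
  rewrite -[RHS]/(word_permanent alpha B (@tagnat.sig1 n (fun i => k i : nat))).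
  by apply: word_permanent_content => i; rewrite content_sig1 -ck cE.
have Nk : #|[pred f | c f == k]| =
    (\sum_(f : {ffun 'I_m -> 'I_n}) [forall i, content f i == k i])%N.
  rewrite -sum1_card big_mkcond /=; apply: eq_bigr => f _; rewrite inE.
  have -> : (c f == k) = [forall i, content f i == k i].
    apply/eqP/forallP => [<- i|H]; first by rewrite cE.
    by apply/ffunP => i; apply/val_inj; rewrite /= cE; exact/eqP.
  by case: [forall i, _].
have : (#|[pred f | c f == k]| * \prod_(i < n) (k i)`!)%N%:R != 0 :> R.
  by rewrite pnatr_eq0 -lt0n Nk (card_words km) fact_gt0.
rewrite natrM mulf_eq0 negb_or => /andP[N0 K0].
rewrite [in RHS]sumr_const -(card_words km) -Nk natrM -natr_prod -mulr_natl.
by field; rewrite N0 K0.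
Qed.

End Words.

(** * Jacobi's formula *)

Lemma deriv_prod_ord (R : comNzRingType) n (F : 'I_n -> {poly R}) :
  (\prod_(i < n) F i)^`() =
  \sum_(i < n) \prod_(j < n) (if j == i then (F j)^`() else F j).
Proof.
elim: n F => [|n IH] F; first by rewrite !big_ord0 -polyC1 derivC.
rewrite big_ord_recl derivM IH [RHS]big_ord_recl; congr (_ + _).
  by rewrite big_ord_recl eqxx; congr (_ * _); apply: eq_bigr.
rewrite mulr_sumr; apply: eq_bigr => i _; rewrite big_ord_recl /=; congr (_ * _).
Qed.

(** Leibniz' rule differentiates one row at a time; expanding each of these
    determinants along its differentiated row gives cofactors. *)
Lemma deriv_det (R : comNzRingType) n (M : 'M[{poly R}]_n) :
  (\det M)^`() = \tr (map_mx (@deriv R) M *m \adj M).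
Proof.
pose M' (i : 'I_n) := \matrix_(j, k) if j == i then (M j k)^`() else M j k.
transitivity (\sum_i \det (M' i)).
  rewrite raddf_sum [RHS]exchange_big /=; apply: eq_bigr => s _.
  rewrite -mulr_sumr -signr_odd; case: (odd _).
    rewrite !expr1 !mulN1r derivN deriv_prod_ord; congr (- _).
    by apply: eq_bigr => i _; apply: eq_bigr => j _; rewrite mxE.
  rewrite !expr0 !mul1r deriv_prod_ord.
  by apply: eq_bigr => i _; apply: eq_bigr => j _; rewrite mxE.
apply: eq_bigr => i _; rewrite (expand_det_row _ i) mxE; apply: eq_bigr => k _.
rewrite !mxE eqxx /cofactor; congr (_ * (_ * \det _)).
by apply/matrixP => j l; rewrite !mxE eq_sym (negbTE (neq_lift _ _)).
Qed.

(** * Bounds for a nonnegative matrix with nonnegative resolvent at 1 *)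

Lemma sum_shift_le (R : numDomainType) (f : nat -> R) i N : (forall j, 0 <= f j) ->
  \sum_(j < N | (i <= j)%N) f (j - i)%N <= \sum_(j < N.+1) f j.
Proof.
move=> f0; rewrite -(@big_geq_mkord _ _ _ i N xpredT (fun j => f (j - i)%N)).
rewrite -{1}(add0n i) big_addn.
under eq_bigr do rewrite addnK.
rewrite -(big_mkord xpredT f) [leRHS](big_cat_nat (n := (N - i)%N)) //=.
  by rewrite lerDl sumr_ge0.
by rewrite (leq_trans (leq_subr _ _)).
Qed.

Section Mmatrix.
Context (R : realType) (n : nat) (B K : 'M[R]_n).
Hypothesis B_ge0 : forall i j, 0 <= B i j.
Hypothesis K_ge0 : forall i j, 0 <= K i j.
Hypothesis BK : (1%:M - B) *m K = 1%:M.

Definition rev_charpoly : {poly R} := \det (1%:M - 'X *: map_mx polyC B).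

Lemma rev_charpolyE t : rev_charpoly.[t] = \det (1%:M - t *: B).
Proof.
rewrite -[LHS]/(horner_eval t rev_charpoly) -det_map_mx; congr determinant.
apply/matrixP => i j; rewrite !mxE /= /horner_eval !hornerE.
by case: eqP; rewrite ?hornerE.
Qed.

Lemma deriv_rev_charpoly t :
  rev_charpoly^`().[t] = - \tr (B *m \adj (1%:M - t *: B)).
Proof.
rewrite deriv_det -[LHS]/(horner_eval t _) -trace_map_mx map_mxM map_mx_adj.
rewrite -[RHS]raddfN -mulNmx; congr (\tr (_ *m \adj _)); apply/matrixP => i j.
  rewrite !mxE /= /horner_eval derivB derivM derivX derivC mulr0 addr0 mul1r.
  by rewrite !hornerE; case: eqP => _; rewrite ?derivC ?deriv0 !hornerE ?sub0r.
rewrite !mxE /= /horner_eval !hornerE.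
by case: eqP; rewrite ?hornerE.
Qed.

Lemma mulmx_ge0 m p r (C : 'M[R]_(m, p)) (D : 'M[R]_(p, r)) :
  (forall i j, 0 <= C i j) -> (forall i j, 0 <= D i j) ->
  forall i j, 0 <= (C *m D) i j.
Proof. by move=> C0 D0 i j; rewrite mxE sumr_ge0 // => k _; rewrite mulr_ge0. Qed.

Lemma expr_mx_ge0 N i j : 0 <= (B ^+ N) i j.
Proof.
elim: N i j => [|N IH] i j; first by rewrite expr0 mxE; case: eqP.
by rewrite exprS -mulmxE mulmx_ge0.
Qed.

Lemma expr_scalemx t N : (t *: B) ^+ N = t ^+ N *: B ^+ N.
Proof.
elim: N => [|N IH]; first by rewrite !expr0 scale1r.
by rewrite !exprS IH -!mulmxE -scalemxAl -scalemxAr scalerA.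
Qed.

Lemma geometric_mx t N :
  (1%:M - t *: B) *m \sum_(m < N) (t *: B) ^+ m = 1%:M - (t *: B) ^+ N.
Proof.
elim: N => [|N IH]; first by rewrite big_ord0 mulmx0 expr0 subrr.
rewrite big_ord_recr /= mulmxDr IH mulmxBl mul1mx mulmxE -exprS.
by rewrite addrA subrK.
Qed.

(** The resolvent K dominates the partial sums of the Neumann series, since
    K = sum_(m <= N) B^m + K B^(N+1) with a nonnegative remainder.  This gives
    t^N B^N -> 0 for t < 1 without any spectral theory. *)
Lemma expr_mx_le N i j : (B ^+ N) i j <= K i j.
Proof.
have KB : K *m (1%:M - B) = 1%:M by exact: mulmx1C.
have E : K = \sum_(m < N.+1) B ^+ m + K *m B ^+ N.+1.
  have := geometric_mx 1 N.+1; rewrite !scale1r => /(congr1 (mulmx K)).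
  rewrite mulmxA KB mul1mx mulmxBr mulmx1 => ->.
  by rewrite subrK.
rewrite {1}E mxE big_ord_recr /= mxE summxE.
rewrite -addrA addrCA lerDl addr_ge0 ?sumr_ge0 //.
- by move=> m _; exact: expr_mx_ge0.
- by apply: mulmx_ge0 => // k l; exact: expr_mx_ge0.
Qed.

Lemma ge0_geometric_bound (t C x : R) : 0 <= t < 1 ->
  (forall N, - (C * t ^+ N) <= x) -> 0 <= x.
Proof.
move=> /andP[t0 t1] H; rewrite -oppr_le0.
have cv : (fun N => C * t ^+ N) @ \oo --> (0 : R).
  by rewrite -[X in _ --> X](mulr0 C); apply: cvgMr; apply: cvg_expr; rewrite ger0_norm.
have := @limr_ge _ _ _ _ (- x) _ (cvgP _ cv).
rewrite (cvg_lim _ cv) //; apply.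
by apply: nearW => N; rewrite lerNl.
Qed.

(** For t < 1, a row vector with v = t v B satisfies v = t^N v B^N for all N, and
    the right-hand side tends to 0; at t = 1 the matrix K is an inverse. *)
Lemma rev_charpoly_neq0 t : 0 <= t <= 1 -> rev_charpoly.[t] != 0.
Proof.
move=> /andP[t0]; rewrite le_eqVlt => /predU1P[->|t1].
  rewrite rev_charpolyE scale1r; apply/eqP => d0.
  have := congr1 determinant BK; rewrite det_mulmx d0 mul0r det1 => /eqP.
  by rewrite eq_sym oner_eq0.
apply/negP; rewrite rev_charpolyE => /det0P[v v0 vB].
have vE N : v = t ^+ N *: (v *m B ^+ N).
  elim: N => [|N IH]; first by rewrite expr0 scale1r expr0 mulmx1.
  move/eqP: vB; rewrite mulmxBr mulmx1 subr_eq0 => /eqP vtB.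
  rewrite {1}vtB -scalemxAr {1}IH -scalemxAl scalerA -exprS.
  by rewrite -mulmxA mulmxE -exprSr.
case/negP: v0; apply/eqP/rowP => i; rewrite mxE; apply/eqP.
rewrite -normr_le0 -oppr_ge0.
apply: (@ge0_geometric_bound t (\sum_k `|v 0 k| * K k i)); first by rewrite t0.
move=> N; rewrite lerN2 {1}(vE N) !mxE normrM ger0_norm ?exprn_ge0 // mulrC.
rewrite ler_wpM2r ?exprn_ge0 // (le_trans (ler_norm_sum _ _ _)) //.
apply: ler_sum => k _; rewrite normrM ler_wpM2l // ger0_norm ?expr_mx_ge0 //.
exact: expr_mx_le.
Qed.

Lemma rev_charpoly_gt0 t : 0 <= t <= 1 -> 0 < rev_charpoly.[t].
Proof.
move=> /andP[t0 t1]; rewrite ltNge; apply/negP => qt.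
have [|s] := @poly_ivt R (- rev_charpoly) 0 t t0.
  rewrite !hornerN oppr_le0 oppr_ge0 qt andbT.
  by rewrite rev_charpolyE scale0r subr0 det1 ler01.
move=> /andP[s0 st] /rootP; rewrite hornerN => /eqP; rewrite oppr_eq0; apply/negP.
by apply: rev_charpoly_neq0; rewrite s0 (le_trans st).
Qed.

(** The adjugate J of 1 - t B satisfies J = q(t) sum_(m < N) t^m B^m + t^N B^N J.
    The sum is nonnegative and the remainder tends to 0. *)
Lemma adj_ge0 t i j : 0 <= t < 1 -> 0 <= (\adj (1%:M - t *: B)) i j.
Proof.
move=> /andP[t0 t1]; set M := 1%:M - t *: B; set J := \adj M.
have q0 : 0 <= \det M by rewrite -rev_charpolyE ltW // rev_charpoly_gt0 // t0 ltW.
apply: (@ge0_geometric_bound t (\sum_k K i k * `|J k j|)); first by rewrite t0.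
move=> N.
have E : J = \det M *: \sum_(m < N) (t *: B) ^+ m + (t *: B) ^+ N *m J.
  have comm : (\sum_(m < N) (t *: B) ^+ m) *m M = M *m \sum_(m < N) (t *: B) ^+ m.
    rewrite !mulmxE mulr_suml mulr_sumr; apply: eq_bigr => m _.
    by rewrite /M mulrBl mulrBr mulr1 mul1r -exprS -exprSr.
  have := congr1 (mulmxr J) (geometric_mx t N); rewrite /= -/M -comm.
  rewrite -mulmxA mul_mx_adj mulmxBl mul1mx mul_mx_scalar => ->.
  by rewrite subrK.
rewrite [in leRHS]E mxE [X in _ <= X + _]mxE summxE -[leLHS]add0r lerD //.
  rewrite mulr_ge0 // sumr_ge0 // => m _.
  by rewrite expr_scalemx mxE mulr_ge0 ?exprn_ge0 ?expr_mx_ge0.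
rewrite expr_scalemx -scalemxAl mxE mxE lerNl -mulrN mulrC ler_wpM2r ?exprn_ge0 //.
rewrite -sumrN; apply: ler_sum => k _; rewrite (le_trans (ler_norm _)) //.
rewrite normrN normrM ler_wpM2r // ger0_norm ?expr_mx_ge0 //; exact: expr_mx_le.
Qed.

(** The logarithmic derivative - q' / q is the full series of the traces; the
    truncation error is a trace of nonnegative matrices. *)
Lemma rev_charpoly_trace_le t N : 0 <= t < 1 ->
  rev_charpoly.[t] * \sum_(m < N) \tr (B ^+ m.+1) * t ^+ m <= - rev_charpoly^`().[t].
Proof.
move=> t01; have /andP[t0 t1] := t01.
rewrite deriv_rev_charpoly opprK rev_charpolyE; set M := 1%:M - t *: B.
have -> : \det M * \sum_(m < N) \tr (B ^+ m.+1) * t ^+ m =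
    \tr (B *m \adj M) - \tr (B *m \adj M *m (t *: B) ^+ N).
  have := congr1 (mulmx (B *m \adj M)) (geometric_mx t N).
  rewrite mulmxBr mulmx1 -/M mulmxA -(mulmxA B) mul_adj_mx => /(congr1 mxtrace).
  rewrite raddfB /= => <-.
  rewrite mul_mx_scalar -scalemxAl mxtraceZ; congr (_ * _).
  rewrite mulmx_sumr raddf_sum; apply: eq_bigr => m _.
  by rewrite /= expr_scalemx -scalemxAr mxtraceZ mulmxE -exprS mulrC.
rewrite gerBl sumr_ge0 // => i _; apply: mulmx_ge0.
  by apply: mulmx_ge0 => // k l; apply: adj_ge0.
by move=> k l; rewrite expr_scalemx mxE mulr_ge0 ?exprn_ge0 ?expr_mx_ge0.
Qed.

Context (alpha : R).
Hypothesis alpha_gt0 : 0 < alpha.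
Local Notation c := (words_coef alpha B).

Lemma tr_expr_ge0 m : 0 <= \tr (B ^+ m).
Proof. by apply: sumr_ge0 => i _; exact: expr_mx_ge0. Qed.

Lemma words_coef_ge0 m : 0 <= c m.
Proof.
elim/ltn_ind: m => -[|m] IH; first by rewrite words_coef0.
rewrite -(pmulr_rge0 _ (ltr0Sn R m)) words_coefS sumr_ge0 // => i _.
apply: mulr_ge0; last by apply: IH; rewrite ltnS leq_subr.
by apply: mulr_ge0; [exact: ltW | exact: tr_expr_ge0].
Qed.

Definition words_poly N : {poly R} := \poly_(j < N.+1) c j.

Lemma words_polyE N t : (words_poly N).[t] = \sum_(j < N.+1) c j * t ^+ j.
Proof. exact: horner_poly. Qed.

Lemma deriv_words_poly N t :
  (words_poly N)^`().[t] = \sum_(j < N) j.+1%:R * c j.+1 * t ^+ j.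
Proof.
have -> : (words_poly N)^`() = \poly_(j < N) (c j.+1 *+ j.+1).
  apply/polyP => j; rewrite coef_deriv !coef_poly ltnS.
  by case: ifP => //; rewrite mul0rn.
by rewrite horner_poly; apply: eq_bigr => j _; rewrite mulr_natl.
Qed.

(** By the recursion, the derivative of the truncation keeps only part of the
    product of the two truncated series, and the terms left out are nonnegative. *)
Lemma deriv_words_poly_le N t : 0 <= t ->
  (words_poly N)^`().[t] <=
  alpha * (\sum_(m < N) \tr (B ^+ m.+1) * t ^+ m) * (words_poly N).[t].
Proof.
move=> t0; rewrite deriv_words_poly words_polyE.
have u0 m : 0 <= alpha * \tr (B ^+ m.+1) * t ^+ m.
  by rewrite !mulr_ge0 ?tr_expr_ge0 ?exprn_ge0 // ltW.
have v0 j : 0 <= c j * t ^+ j by rewrite mulr_ge0 ?words_coef_ge0 ?exprn_ge0.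
have -> : \sum_(j < N) j.+1%:R * c j.+1 * t ^+ j =
   \sum_(j < N) \sum_(i < N | (i <= j)%N)
      (alpha * \tr (B ^+ i.+1) * t ^+ i) * (c (j - i) * t ^+ (j - i)).
  apply: eq_bigr => j _; rewrite words_coefS mulr_suml.
  rewrite (big_ord_widen_cond N xpredT
    (fun i => alpha * \tr (B ^+ i.+1) * c (j - i) * t ^+ j)) //=.
  apply: eq_big => i //= ij.
  have -> : t ^+ j = t ^+ i * t ^+ (j - i) by rewrite -exprD subnKC.
  ring.
rewrite (exchange_big_dep xpredT) //= [X in _ <= X * _]mulr_sumr [leRHS]mulr_suml.
apply: ler_sum => i _.
rewrite -mulr_sumr mulrA ler_wpM2l //.
exact: (@sum_shift_le R (fun j => c j * t ^+ j)).
Qed.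

Let H N t := (words_poly N).[t] * rev_charpoly.[t] `^ alpha.

Let dH N (t : R) : 0 <= t <= 1 -> is_derive t 1 (H N)
  ((words_poly N).[t] * (alpha * rev_charpoly.[t] `^ (alpha - 1) * rev_charpoly^`().[t])
   + rev_charpoly.[t] `^ alpha * (words_poly N)^`().[t]).
Proof.
move=> t01; have q0 := rev_charpoly_gt0 t01.
have d1 := @is_derive1_powR R alpha _ q0.
have d2 := @is_derive1_comp R _ _ _ _ _ d1 (is_derive_poly rev_charpoly t).
exact: is_deriveM (is_derive_poly (words_poly N) t) d2.
Qed.

Let H_nincr N (s t : R) : 0 <= s -> s <= t -> t <= 1 -> H N t <= H N s.
Proof.
move=> s0 st t1; apply: (@ler0_derive1_le_cc R (H N) 0 1) => //.
- move=> x; rewrite in_itv /= => /andP[x0 x1].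
  by apply: (@ex_derive _ _ _ _ _ _ _ (@dH N x _)); rewrite !ltW.
- move=> x; rewrite in_itv /= => /andP[x0 x1].
  have x01 : 0 <= x <= 1 by rewrite !ltW.
  have q0 := rev_charpoly_gt0 x01.
  rewrite derive1E (@derive_val _ _ _ _ _ _ _ (@dH N x x01)).
  have -> : rev_charpoly.[x] `^ alpha =
      rev_charpoly.[x] * rev_charpoly.[x] `^ (alpha - 1).
    by rewrite mulr_powRB1 // ltW.
  set pw := rev_charpoly.[x] `^ (alpha - 1).
  have pw0 : 0 <= pw by exact: powR_ge0.
  have dF := deriv_words_poly_le N (ltW x0).
  have dq : rev_charpoly.[x] * \sum_(m < N) \tr (B ^+ m.+1) * x ^+ m <=
      - rev_charpoly^`().[x].
    by apply: rev_charpoly_trace_le; rewrite ltW.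
  set S := \sum_(m < N) _ in dF dq.
  have F0 : 0 <= (words_poly N).[x].
    rewrite words_polyE sumr_ge0 // => j _.
    by rewrite mulr_ge0 ?words_coef_ge0 ?exprn_ge0 // ltW.
  set F := (words_poly N).[x] in dF F0 *; set F' := _^`().[x] in dF *.
  set q := rev_charpoly.[x] in q0 dq *; set q' := rev_charpoly^`().[x] in dq *.
  have -> : F * (alpha * pw * q') + q * pw * F' = pw * (alpha * F * q' + q * F') by ring.
  rewrite mulr_ge0_le0 //.
  apply: (@le_trans _ _ (alpha * F * q' + q * (alpha * S * F))).
    by rewrite lerD2l ler_wpM2l // ltW.
  have -> : alpha * F * q' + q * (alpha * S * F) = alpha * F * (q' + q * S) by ring.
  rewrite mulr_ge0_le0 //; first by rewrite mulr_ge0 // ltW.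
  by lra.
- apply: derivable_within_continuous => x; rewrite in_itv /= => x01.
  exact: (@ex_derive _ _ _ _ _ _ _ (@dH N x x01)).
- by rewrite in_itv /= (le_trans s0 st) t1.
- by rewrite in_itv /= s0 (le_trans st t1).
Qed.

(** H_N = F_N q^alpha is nonincreasing, so F_N(t) q(t)^alpha lies between its value
    at 1 and its value at 0.  The latter is 1, and the former tends to 1 exactly
    because the c_j have the sum assumed in the first hypothesis. *)
Lemma words_series (t : R) :
  (fun N => \sum_(j < N.+1) c j) @ \oo --> (\det (1%:M - B)) `^ (- alpha) ->
  0 <= t <= 1 ->
  (fun N => \sum_(j < N.+1) c j * t ^+ j) @ \oo -->
    (\det (1%:M - t *: B)) `^ (- alpha).
Proof.
move=> mass /andP[t0 t1].
have q0 : 0 < rev_charpoly.[t] by rewrite rev_charpoly_gt0 // t0.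
have q1 : 0 < rev_charpoly.[1] by rewrite rev_charpoly_gt0 // ler01 lexx.
have qE : rev_charpoly.[1] = \det (1%:M - B) by rewrite rev_charpolyE scale1r.
rewrite -rev_charpolyE powRN.
have low N : (\sum_(j < N.+1) c j) * rev_charpoly.[1] `^ alpha / rev_charpoly.[t] `^ alpha
    <= \sum_(j < N.+1) c j * t ^+ j.
  rewrite ler_pdivrMr ?powR_gt0 // -words_polyE.
  have := @H_nincr N t 1 t0 t1 (lexx 1); rewrite /H words_polyE.
  by under eq_bigr do rewrite expr1n mulr1.
have up N : \sum_(j < N.+1) c j * t ^+ j <= (rev_charpoly.[t] `^ alpha)^-1.
  rewrite -[leRHS]mul1r ler_pdivlMr ?powR_gt0 // -words_polyE.
  apply: le_trans (@H_nincr N 0 t (lexx 0) t0 t1) _; rewrite /H.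
  rewrite rev_charpolyE scale0r subr0 det1 powR1 mulr1 words_polyE big_ord_recl.
  rewrite expr0 mulr1 words_coef0 big1 ?addr0 // => j _.
  by rewrite expr0n mulr0.
pose L N := (\sum_(j < N.+1) c j) * rev_charpoly.[1] `^ alpha / rev_charpoly.[t] `^ alpha.
have cL : L @ \oo --> (rev_charpoly.[t] `^ alpha)^-1; last first.
  apply: (squeeze_cvgr _ cL (cvg_cst _)).
  by apply: nearW => N; rewrite low up.
have -> : (rev_charpoly.[t] `^ alpha)^-1 =
    (\det (1%:M - B)) `^ (- alpha) * rev_charpoly.[1] `^ alpha / rev_charpoly.[t] `^ alpha.
  by rewrite -qE powRN mulVf ?mul1r // gt_eqF // powR_gt0.
by apply: cvgMl; apply: cvgMl.
Qed.

End Mmatrix.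

(** * Uniqueness of the Laplace transform on the half line *)

Section TailPolynomials.
Context (R : realType).

Lemma bernoulli_ineq (y : R) m : 0 <= y <= 1 -> 1 - m%:R * y <= (1 - y) ^+ m.
Proof.
move=> /andP[y0 y1]; elim: m => [|m IH]; first by rewrite mul0r subr0 expr0.
rewrite exprS; apply: le_trans (ler_wpM2l _ IH); last by rewrite subr_ge0.
have : 0 <= m%:R * (y * y) by rewrite !mulr_ge0.
rewrite -natr1; nra.
Qed.

(** The factor [k.+1] in the exponent beyond exp((k+1) b) makes the limit 0 at
    x = b too; without it the limit there would be exp(-1). *)
Definition tail_exponent (b : R) (k : nat) : nat :=
  (k.+1 * (Num.trunc (expR (k.+1%:R * b))).+1)%N.

Definition tail_poly (b : R) (k : nat) : {poly R} :=
  (1 - 'X^(k.+1)) ^+ tail_exponent b k.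

Lemma tail_polyE b k x : (tail_poly b k).[expR (- x)] =
  (1 - expR (- (k.+1%:R * x))) ^+ tail_exponent b k.
Proof.
by rewrite horner_exp !hornerE -expRM_natl mulrN.
Qed.

Lemma tail_poly_ge0 b k x : 0 <= x -> 0 <= (tail_poly b k).[expR (- x)] <= 1.
Proof.
move=> x0; rewrite tail_polyE.
have e1 : expR (- (k.+1%:R * x)) <= 1 by rewrite -expR0 ler_expR oppr_le0 mulr_ge0.
have e0 := expR_ge0 (- (k.+1%:R * x)).
by rewrite exprn_ge0 ?subr_ge0 //= exprn_ile1 ?subr_ge0 // lerBlDr lerDl.
Qed.

Lemma cvg_inv_nat (C : R) : (fun k => C / k.+1%:R) @ \oo --> (0 : R).
Proof.
by rewrite -[X in _ --> X](mulr0 C); apply: cvgMr; exact: cvg_harmonic.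
Qed.

(** Any superlinear bound would do: it makes (k+1) exp(- (k+1) d) tend to 0. *)
Lemma expR_sqr_bound (y : R) : 0 <= y -> y ^+ 2 <= 4 * expR y.
Proof.
move=> y0; have -> : expR y = expR (y / 2) ^+ 2.
  by rewrite -expRM_natl; congr expR; field.
have h := expR_ge1Dx (y / 2).
have : (y / 2) ^+ 2 <= expR (y / 2) ^+ 2 by rewrite ler_sqr ?nnegrE ?divr_ge0 ?expR_ge0 //; lra.
by rewrite expr_div_n; lra.
Qed.

(** With y = exp(- (k+1) x) and m the exponent, m y tends to infinity if x <= b
    and to 0 if x > b; then (1 - y)^m <= exp(- m y) gives the limit 0 in the first
    case, and (1 - y)^m >= 1 - m y the limit 1 in the second. *)
Lemma cvg_tail_poly (b x : R) : 0 <= b -> 0 <= x ->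
  (fun k => (tail_poly b k).[expR (- x)]) @ \oo --> (\1_(`]b, +oo[ : set R) x : R).
Proof.
move=> b0 x0; rewrite indicE; have [xb|bx] := leP x b.
  rewrite memNset; last by rewrite /= in_itv /= andbT; apply/negP; rewrite -leNgt.
  apply: (squeeze_cvgr _ (cvg_cst 0) (cvg_inv_nat 1)).
  apply: nearW => k; have /andP[-> _] := tail_poly_ge0 b k x0.
  rewrite tail_polyE.
  set K : R := k.+1%:R; set y := expR (- (K * x)).
  have K0 : 0 < K by rewrite ltr0n.
  have m_big : K * expR (K * b) <= (tail_exponent b k)%:R.
    rewrite /tail_exponent natrM ler_wpM2l ?(ltW K0) //.
    exact/ltW/truncnS_gt.
  have my : K <= (tail_exponent b k)%:R * y.
    apply: le_trans (ler_wpM2r (expR_ge0 _) m_big).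
    rewrite -mulrA -expRD ler_peMr ?(ltW K0) //.
    rewrite -expR0 ler_expR -mulrBr mulr_ge0 ?(ltW K0) //.
    by rewrite subr_ge0.
  have y1 : 0 <= 1 - y.
    by rewrite subr_ge0 -expR0 ler_expR oppr_le0 mulr_ge0 // ltW.
  apply: (@le_trans _ _ (expR (- y) ^+ tail_exponent b k)).
    rewrite lerXn2r ?nnegrE ?expR_ge0 //.
    by have := expR_ge1Dx (- y).
  rewrite -expRM_natl mulrN expRN div1r lef_pV2 ?posrE ?expR_gt0 //.
  apply: le_trans my _; apply: le_trans (expR_ge1Dx _).
  by rewrite lerDr.
rewrite mem_set /=; last by rewrite /= in_itv /= andbT.
pose C := 8 / (x - b) ^+ 2.
have cC : (fun k => 1 - C / k.+1%:R) @ \oo --> (1 : R).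
  by rewrite -[X in _ --> X]subr0; apply: cvgB; [exact: cvg_cst|exact: cvg_inv_nat].
apply: (squeeze_cvgr _ cC (cvg_cst (1 : R))).
apply: nearW => k; have /andP[_ ->] := tail_poly_ge0 b k x0.
rewrite tail_polyE andbT.
set K : R := k.+1%:R; set y := expR (- (K * x)).
have K0 : 0 < K by rewrite ltr0n.
have y01 : 0 <= y <= 1.
  by rewrite expR_ge0 -expR0 ler_expR oppr_le0 mulr_ge0 // ltW.
apply: le_trans (bernoulli_ineq _ y01); rewrite lerD2l lerN2.
have E1 : 1 <= expR (K * b) by rewrite -expR0 ler_expR mulr_ge0 // ltW.
have m_small : (tail_exponent b k)%:R <= K * (2 * expR (K * b)).
  rewrite /tail_exponent natrM ler_wpM2l ?(ltW K0) // -natr1.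
  have := truncn_le (expR (K * b)); rewrite expR_ge0 => t; lra.
apply: le_trans (ler_wpM2r (expR_ge0 _) m_small) _.
have d0 : 0 < x - b by rewrite subr_gt0.
have := expR_sqr_bound (mulr_ge0 (ltW K0) (ltW d0)).
have -> : K * (2 * expR (K * b)) * y = 2 * K / expR (K * (x - b)).
  have e : expR (K * b) * y = expR (- (K * (x - b))).
    by rewrite -expRD; congr expR; ring.
  by rewrite -expRN -e; ring.
move=> sq; rewrite ler_pdivrMr ?expR_gt0 //.
rewrite /C; have -> : 8 / (x - b) ^+ 2 / K * expR (K * (x - b)) =
   2 * K * (4 * expR (K * (x - b)) / (K * (x - b)) ^+ 2).
  by field; rewrite !gt_eqF.
by rewrite ler_peMr ?mulr_ge0 ?(ltW K0) // ler_pdivlMr ?mul1r // exprn_gt0 // mulr_gt0.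
Qed.

End TailPolynomials.

Section Laplace.
Context (R : realType).
Implicit Types mu nu : probability (measurableTypeR R) R.

Let D : set (measurableTypeR R) := `[0, +oo[.

Let mD : measurable D. Proof. exact: measurable_itv. Qed.

Lemma measurable_horner_expRN (p : {poly R}) (A : set (measurableTypeR R)) :
  measurable_fun A (fun x : measurableTypeR R => p.[expR (- x)] : R).
Proof.
apply: measurable_funTS; apply: continuous_measurable_fun => x.
apply: (@continuous_comp _ _ _ (fun x => expR (- x)) (horner p)).
  apply: (@continuous_comp _ _ _ -%R (@expR R)); first exact: opp_continuous.
  exact: continuous_expR.
exact: continuous_horner.
Qed.

Let integrable_horner_expRN mu (p : {poly R}) :
  mu.-integrable D (fun x => (p.[expR (- x)])%:E).
Proof.
apply: measurable_bounded_integrable => //.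
- by rewrite (le_lt_trans (probability_le1 _ _)) // ltry.
- exact: measurable_horner_expRN.
- exists (\sum_(i < size p) `|p`_i|); split; first exact: num_real.
  move=> M pM x Dx; apply: le_trans (ltW pM).
  rewrite horner_coef; apply: le_trans (ler_norm_sum _ _ _) _.
  apply: ler_sum => i _; rewrite normrM ler_piMr // normrX.
  rewrite ger0_norm ?expR_ge0 // exprn_ile1 ?expR_ge0 // -expR0 ler_expR oppr_le0.
  by move: Dx; rewrite /D /= in_itv /= andbT.
Qed.

Let integral_horner_expRN mu (p : {poly R}) :
  (\int[mu]_(x in D) (p.[expR (- x)])%:E =
   \sum_(i < size p) (p`_i)%:E * \int[mu]_(x in D) (expR (- x) ^+ i)%:E)%E.
Proof.
have iX i : mu.-integrable D (fun x => (expR (- x) ^+ i)%:E).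
  have := integrable_horner_expRN mu 'X^i; apply: eq_integrable => // x _.
  by rewrite hornerXn.
under [RHS]eq_bigr do rewrite -(integralZl mD (iX _)).
rewrite -integral_sum //; last by move=> i; exact: integrableZl.
by apply: eq_integral => x _; rewrite horner_coef -sumEFin.
Qed.

Let cvg_integral_tail_poly mu b : 0 <= b ->
  (fun k => \int[mu]_(x in D) ((tail_poly b k).[expR (- x)])%:E)%E @ \oo -->
  mu `]b, +oo[%classic.
Proof.
move=> b0.
have := @dominated_convergence _ _ _ mu D mD
  (fun k x => ((tail_poly b k).[expR (- x)])%:E) (fun x => (\1_(`]b, +oo[ : set R) x)%:E)
  (cst 1%E).
case.
- by move=> k; apply/measurable_EFinP; exact: measurable_horner_expRN.
- by apply/measurable_EFinP; apply: measurable_indic.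
- apply: aeW => x; rewrite /D /= in_itv /= andbT => x0.
  by apply: cvg_EFin; [exact: nearW|exact: cvg_tail_poly].
- exact: finite_measure_integrable_cst.
- apply: aeW => x k; rewrite /D /= in_itv /= andbT => x0.
  have /andP[p0 p1] := tail_poly_ge0 b k x0.
  by rewrite lee_fin ger0_norm.
move=> _ _; rewrite integral_indic // setIidl //.
by move=> x; rewrite /D /= !in_itv /= !andbT => /ltW; exact: le_trans.
Qed.

(** Dominated convergence along [tail_poly] recovers the mass of every ]b, +oo[
    from the integrals of the exp(- m x), hence the distribution function. *)
Lemma laplace_unique mu nu :
  mu `]-oo, 0[%classic = 0%E -> nu `]-oo, 0[%classic = 0%E ->
  (forall m : nat, \int[mu]_x (expR (- x) ^+ m)%:E = \int[nu]_x (expR (- x) ^+ m)%:E)%E ->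
  forall A, measurable A -> mu A = nu A.
Proof.
move=> mu0 nu0 munu.
have onD (m : probability (measurableTypeR R) R) i : m `]-oo, 0[%classic = 0%E ->
    (\int[m]_(x in D) (expR (- x) ^+ i)%:E = \int[m]_x (expR (- x) ^+ i)%:E)%E.
  move=> m0; rewrite [RHS](ge0_negligible_integral _ _ _ _ m0) //.
  - by rewrite setTD setCitvl.
  - apply/measurable_EFinP; have := @measurable_horner_expRN 'X^i setT.
    by apply: eq_measurable_fun => x _; rewrite hornerXn.
have tail b : 0 <= b -> mu `]b, +oo[%classic = nu `]b, +oo[%classic.
  move=> b0; apply: (@cvg_unique _ _ _ _ _ _ (@cvg_integral_tail_poly mu b b0)).
    exact: ereal_hausdorff.
  rewrite (_ : (fun k => _) =
    (fun k => \int[nu]_(x in D) ((tail_poly b k).[expR (- x)])%:E)%E).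
    exact: cvg_integral_tail_poly.
  apply/funext => k; rewrite !integral_horner_expRN; apply: eq_bigr => i _.
  by rewrite !onD // munu.
have cdf_eq b : mu `]-oo, b]%classic = nu `]-oo, b]%classic.
  have [b0|b0] := leP 0 b.
    rewrite -(setCitvr (BRight b)) !probability_setC //.
    by congr (1 - _)%E; exact: tail.
  have null (m : probability (measurableTypeR R) R) : m `]-oo, 0[%classic = 0%E ->
      m `]-oo, b]%classic = 0%E.
    move=> m0; apply/eqP; rewrite eq_le measure_ge0 andbT -[leRHS]m0.
    by apply: le_measure; rewrite ?inE //; apply: subset_itvl; rewrite bnd_simp.
  by rewrite !null.
move=> A mA; rewrite -(lebesgue_stieltjes_cdf_id mu mA).
apply: lebesgue_stieltjes_measure_unique => // X [[a b]] /= _ <-.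
rewrite lebesgue_stieltjes_cdf_id //.
have [ab|ba] := leP a b; last by rewrite set_itv_ge ?measure0 // bnd_simp -leNgt ltW.
have E : `]a, b]%classic = `]-oo, b] `\` `]-oo, a] :> set R.
  by rewrite -[RHS]setCK setCD setCitvl setUC -[LHS]setCK setCitv.
have sub : (`]-oo, a] : set R) `<=` `]-oo, b] by apply: subset_itvl; rewrite bnd_simp.
have diff (m : probability (measurableTypeR R) R) (U V : set (measurableTypeR R)) :
    measurable U -> measurable V -> U `<=` V -> m (V `\` U) = (m V - m U)%E.
  move=> mU mV UV; rewrite measureD ?setIidr //.
  by rewrite (le_lt_trans (probability_le1 _ _)) // ltry.
by rewrite E !diff // !cdf_eq.
Qed.

End Laplace.

(** * Integration against a density, and dilations of the line *)

Section Density.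
Local Open Scope ereal_scope.
Context d (T : measurableType d) (R : realType).
Variables (mu m : {measure set T -> \bar R}) (h : T -> \bar R).
Hypothesis mh : measurable_fun [set: T] h.
Hypothesis h_ge0 : forall x, 0 <= h x.
Hypothesis density : forall A, measurable A -> m A = \int[mu]_(x in A) h x.
Import HBNNSimple.

Lemma ge0_integral_density (g : T -> R) :
  measurable_fun [set: T] g -> (forall x, (0 <= g x)%R) ->
  \int[m]_x (g x)%:E = \int[mu]_x ((g x)%:E * h x).
Proof.
move=> mg g0; pose f x := (g x)%:E.
have f0 x : 0 <= f x by rewrite lee_fin.
have mf : measurable_fun [set: T] f by exact/measurable_EFinP.
rewrite -[LHS]/(\int[m]_x f x) -[RHS]/(\int[mu]_x (f x * h x)).
pose f_ := nnsfun_approx measurableT mf.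
have cf_ x : (EFin \o f_^~ x) n @[n --> \oo] --> f x by exact: cvg_nnsfun_approx.
have le_approx x n : (f_ n x)%:E <= f x.
  by rewrite nnsfun_approxE; exact: measurable_fun_approximation.le_approx.
transitivity (limn (fun n => \int[m]_x (f_ n x)%:E)).
  rewrite -monotone_convergence //.
  - by apply: eq_integral => x _; apply/esym/cvg_lim => //; exact: cf_.
  - by move=> n; exact/measurable_EFinP.
  - by move=> n x _; rewrite lee_fin.
  - by move=> x _ a b ab; rewrite lee_fin; exact/lefP/nd_nnsfun_approx.
transitivity (limn (fun n => \int[mu]_x ((f_ n x)%:E * h x))); last first.
  rewrite -monotone_convergence //.
  - apply: eq_integral => x _; apply/cvg_lim => //.
    have [fx0|fx0] := eqVneq (f x) 0.
      rewrite fx0 mul0e (_ : (fun n => _) = cst 0); first exact: cvg_cst.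
      apply/funext => n /=; have := le_approx x n; rewrite fx0 => fn0.
      suff -> : (f_ n x)%:E = 0 by rewrite mul0e.
      by apply/le_anti/andP; split; [exact: fn0|rewrite lee_fin].
    apply: cvgeM; [|exact: cf_|exact: cvg_cst].
    by move: fx0; rewrite /f eqe; case: (h x).
  - by move=> n; apply: emeasurable_funM => //; exact/measurable_EFinP.
  - by move=> n x _; rewrite mule_ge0 // lee_fin.
  - move=> x _ a b ab; rewrite lee_wpmul2r // lee_fin.
    exact/lefP/nd_nnsfun_approx.
congr (limn _); apply/funext => n.
rewrite integralT_nnsfun sintegralE.
under eq_fsbigr do rewrite density //.
transitivity (\sum_(r \in range (f_ n)) \int[mu]_x (r%:E * (h \_ (f_ n @^-1` [set r])) x)).
  apply: eq_fsbigr => r; rewrite inE => -[y _ <-].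
  rewrite ge0_integralZl_EFin -?integral_mkcond //.
  - by move=> x _; rewrite patchE; case: ifP.
  - by apply/(measurable_restrictT _ _).1 => //; exact: measurable_funS mh.
rewrite -ge0_integral_fsum //.
- apply: eq_integral => x _; rewrite (fsbigD1 (f_ n x)) //=; last by exists x.
  rewrite patchE mem_set // fsbig1 ?adde0 // => r [_ /= rx].
  by rewrite patchE memNset ?mule0 //= => /esym.
- move=> r; apply: measurable_funeM.
  by apply/(measurable_restrictT _ _).1 => //; exact: measurable_funS mh.
- move=> r x _; have [r0|r0] := leP 0%R r.
    by rewrite mule_ge0 ?lee_fin // patchE; case: ifP.
  by rewrite preimage_nnfun0 // patchE memNset ?mule0.
Qed.

End Density.

Section Scaling.
Context (R : realType).
Local Notation mu := (@lebesgue_measure R).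

(** Both sides are integrals against the same measure: c times the image of
    Lebesgue measure under x -> c x is Lebesgue measure, by a look at intervals. *)
Lemma ge0_integral_scale (c : R) (f : R -> \bar R) : 0 < c ->
  measurable_fun [set: R] f -> (forall x, 0 <= f x)%E ->
  (\int[mu]_x f x = c%:E * \int[mu]_x f (c * x)%R)%E.
Proof.
move=> c0 mf f0.
have mc : measurable_fun [set: measurableTypeR R]
    (fun x : measurableTypeR R => c * x : measurableTypeR R).
  by apply: measurable_funM.
pose m' : {measure set (measurableTypeR R) -> \bar R} :=
  mscale (NngNum (ltW c0))
    (pushforward mu (fun x : measurableTypeR R => c * x : measurableTypeR R)).
transitivity (\int[m' mc]_x f x)%E.
  apply: eq_measure_integral => A mA _; apply: lebesgue_measure_unique => //.
  move=> _ [[a b]] _ <-; rewrite /m' /= /mscale /= /pushforward.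
  rewrite (_ : _ @^-1` _ = `]a / c, b / c]%classic).
    rewrite !lebesgue_measure_itv /= !lte_fin ltr_pM2r ?invr_gt0 //.
    case: ifP => _; last by rewrite mule0.
    by rewrite -EFinD -EFinM; congr EFin; field; rewrite gt_eqF.
  apply/seteqP; split => x /=; rewrite !in_itv /= ltr_pdivrMr // ler_pdivlMr //.
    by rewrite (mulrC x).
  by rewrite (mulrC x).
rewrite ge0_integral_mscale //= ge0_integral_pushforward //.
Qed.

Lemma gamma_pdf_ge0 u v (x : R) : 0 <= v -> 0 <= gamma_pdf u v x.
Proof.
move=> v0; rewrite /gamma_pdf; case: ifP => // _.
rewrite !mulr_ge0 ?powR_ge0 ?expR_ge0 // invr_ge0 Rintegral_ge0 // => y _.
by rewrite mulr_ge0 ?powR_ge0 ?expR_ge0.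
Qed.

Lemma measurable_gamma_pdf u v : measurable_fun [set: R] (gamma_pdf u v).
Proof.
apply: measurable_fun_ifT.
- exact: measurable_fun_ltr.
- apply: measurable_funM => //; apply: measurable_funM.
    by apply: measurable_funM => //; exact: measurable_powR.
  by apply: measurableT_comp => //; apply: measurable_funN; exact: measurable_funM.
- exact: measurable_cst.
Qed.

(** With c = m + 1, the density at c x is c^(u-1) exp(- m x) times the density
    at x, so the identity is the dilation by c.  The mass of the density stays as a
    factor, so the identity holds for every u. *)
Lemma laplace_gamma_pdf u (m : nat) :
  (\int[mu]_x (expR (- x) ^+ m * gamma_pdf u 1 x)%:E =
   (m.+1%:R `^ (- u))%:E * gamma_law u 1 [set: R])%E.
Proof.
have c0 : (0 : R) < m.+1%:R by rewrite ltr0n.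
rewrite /gamma_law (@ge0_integral_scale _ (fun x => (gamma_pdf u 1 x)%:E) c0); first last.
- by move=> x; rewrite lee_fin gamma_pdf_ge0.
- by apply/measurable_EFinP; apply: measurable_gamma_pdf.
under [in RHS]eq_integral => x _.
  have -> : gamma_pdf u 1 (m.+1%:R * x) =
      m.+1%:R `^ (u - 1) * (expR (- x) ^+ m * gamma_pdf u 1 x).
    rewrite /gamma_pdf pmulr_rgt0 //; case: ifP => [x0|_]; last by rewrite !mulr0.
    rewrite !powR1 !mul1r powRM ?ltW // -expRM_natl.
    rewrite (_ : - (m.+1%:R * x) = m%:R * - x + - x); last by rewrite -natr1; ring.
    by rewrite expRD; ring.
  rewrite EFinM; over.
have pos x : 0 <= expR (- x) ^+ m * gamma_pdf u 1 x.
  by rewrite mulr_ge0 ?exprn_ge0 ?expR_ge0 ?gamma_pdf_ge0.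
rewrite ge0_integralZl_EFin ?powR_ge0 //; first last.
- apply/measurable_EFinP/measurable_funM; last exact: measurable_gamma_pdf.
  apply: measurable_funX; apply: measurableT_comp => //.
- by move=> x _; rewrite lee_fin.
rewrite !muleA -!EFinM -[X in _ * X * _]powRr1 ?(ltW c0) // -!powRD ?(gt_eqF c0) ?implybT //.
by rewrite (_ : - u + 1 + (u - 1) = 0) ?powRr0 ?mul1e //; ring.
Qed.

End Scaling.

(** * Gamma mixtures *)

Section Law.
Context (R : realType) (d : measure_display) (T : measurableType d) (P : probability T R).
Context (f : T -> R) (mf : measurable_fun [set: T] f).

Let mf' : measurable_fun [set: T] (f : T -> measurableTypeR R). Proof. exact: mf. Qed.

(** The image law is taken on [measurableTypeR R], the copy of R that carries
    Lebesgue measure, so that it can be compared with Lebesgue integrals. *)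
Definition borel_law : probability (measurableTypeR R) R :=
  distribution P (HB.pack (f : T -> measurableTypeR R)
    (isMeasurableFun.Build _ _ _ _ (f : T -> measurableTypeR R) mf')
    : {mfun T >-> measurableTypeR R}).

Lemma ge0_integral_borel_law (g : R -> R) :
  measurable_fun [set: R] g -> (forall x, 0 <= g x) ->
  (\int[borel_law]_x (g x)%:E = \int[P]_w (g (f w))%:E)%E.
Proof.
move=> mg g0; rewrite ge0_integral_distribution //.
by apply/measurable_EFinP; exact: mg.
Qed.

End Law.

Section Mixture.
Context (R : realType) (d : measure_display) (T : measurableType d) (P : probability T R).
Context (r : R) (N : T -> nat) (W : {RV P >-> R}).
Hypothesis mN : forall j, measurable [set w | N w = j].
Hypothesis mixW : gamma_mixture r N W.
Local Notation lawW := (borel_law P (measurable_funPT W)).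
Local Notation mu := (@lebesgue_measure R).

Lemma bigcup_level_sets : \bigcup_j [set w | N w = j] = [set: T].
Proof. by apply/seteqP; split => // w _; exists (N w). Qed.

Lemma trivIset_level_sets : trivIset setT (fun j => [set w | N w = j]).
Proof. by apply/trivIsetP => i j _ _ /eqP ij; apply/seteqP; split=> // w [/= -> /ij]. Qed.

Let pr j : R := fine (P [set w | N w = j]).

Let prE j : P [set w | N w = j] = (pr j)%:E.
Proof. by rewrite fineK // fin_num_measure. Qed.

Let h (x : R) : \bar R := (\sum_(j <oo) (pr j)%:E * (gamma_pdf (r + j%:R) 1 x)%:E)%E.

Let term_ge0 j (x : R) : (0 <= (pr j)%:E * (gamma_pdf (r + j%:R) 1 x)%:E)%E.
Proof. by rewrite mule_ge0 // lee_fin ?gamma_pdf_ge0 // fine_ge0. Qed.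

Let measurable_term j :
  measurable_fun [set: R] (fun x => ((pr j)%:E * (gamma_pdf (r + j%:R) 1 x)%:E)%E).
Proof.
apply: measurable_funeM; apply/measurable_EFinP; exact: measurable_gamma_pdf.
Qed.

Let distribution_density (A : set (measurableTypeR R)) : measurable A ->
  lawW A = (\int[mu]_(x in A) h x)%E.
Proof.
move=> mA; rewrite integral_nneseries //; last first.
  by move=> j; apply: measurable_funTS; exact: measurable_term.
have mW : measurable (W @^-1` A) by rewrite -[_ @^-1` _]setTI; exact: measurable_funP.
transitivity (P (\bigcup_j ([set w | N w = j] `&` W @^-1` A))).
  by rewrite -setI_bigcupl bigcup_level_sets setTI.
rewrite measure_bigcup //; last 2 first.
- by move=> j _; exact: measurableI.
- exact/trivIset_setIr/trivIset_level_sets.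
rewrite (eq_eseriesl (Q := xpredT)); last by move=> j; rewrite in_setT.
apply: eq_eseriesr => j _; apply: etrans (mixW j mA) _.
rewrite prE /gamma_law ge0_integralZl_EFin //.
- by move=> x _; rewrite lee_fin gamma_pdf_ge0.
- by apply: measurable_funTS; apply/measurable_EFinP; apply: measurable_gamma_pdf.
- exact: fine_ge0.
Qed.

Lemma gamma_mixture_lt0 : lawW `]-oo, 0[%classic = 0%E.
Proof.
rewrite distribution_density //; apply: integral0_eq => x; rewrite /= in_itv /= => x0.
rewrite /h eseries0 // => j _ _; rewrite /gamma_pdf ltNge (ltW x0) /= mule0 //.
Qed.

(** Applying the mixture hypothesis to the whole line shows that the j-th gamma
    density has mass 1 as soon as N = j has positive probability, which removes the
    masses left by [laplace_gamma_pdf]. *)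
Lemma laplace_gamma_mixture (m : nat) :
  (\int[lawW]_x (expR (- x) ^+ m)%:E =
   \sum_(j <oo) P [set w | N w = j] * (m.+1%:R `^ (- (r + j%:R)))%:E)%E.
Proof.
have mX : measurable_fun [set: R] (fun x : R => expR (- x) ^+ m).
  by apply: measurable_funX; apply: measurableT_comp.
have mh : measurable_fun [set: R] h by apply: ge0_emeasurable_sum => // j _.
have h0 x : (0 <= h x)%E by exact: nneseries_ge0.
have X0 x : 0 <= expR (- x) ^+ m :> R by rewrite exprn_ge0 // expR_ge0.
rewrite (@ge0_integral_density _ _ _ mu lawW h mh h0 distribution_density _ mX X0).
under eq_integral => x _ do rewrite -nneseriesZl //.
rewrite integral_nneseries //; last 2 first.
- move=> j; apply: emeasurable_funM; [|exact: measurable_term].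
  by apply/measurable_EFinP; exact: mX.
- by move=> j x _; rewrite mule_ge0 // lee_fin.
apply: eq_eseriesr => j _.
under eq_integral => x _ do rewrite muleCA -EFinM.
under eq_integral => x _ do rewrite EFinM.
rewrite ge0_integralZl_EFin //; last 3 first.
- by move=> x _; rewrite lee_fin mulr_ge0 ?exprn_ge0 ?expR_ge0 ?gamma_pdf_ge0.
- by apply/measurable_EFinP; apply: measurable_funM => //; apply: measurable_gamma_pdf.
- exact: fine_ge0.
rewrite laplace_gamma_pdf -prE muleCA [RHS]muleC; congr (_ * _)%E.
by rewrite -mixW // preimage_setT setIT.
Qed.

End Mixture.

(** * Diagonal scaling of an M-matrix *)

Section DiagonalScaling.
Context (R : realType) (n : nat) (A : 'M[R]_n).
Hypothesis hA : nonsingular_M_matrix A.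

(** In the (i, i) entry of A A^-1 = 1 the off-diagonal terms are nonpositive, so
    the diagonal term is at least 1. *)
Lemma M_matrix_diag_gt0 i : 0 < A i i.
Proof.
have [A0 uA K0] := hA.
have := congr1 (fun M : 'M[R]_n => M i i) (mulmxV uA).
rewrite !mxE eqxx (bigD1 i) //= => E.
have S0 : \sum_(k < n | k != i) A i k * invmx A k i <= 0.
  by apply: sumr_le0 => k ki; rewrite mulr_le0_ge0 // A0 // eq_sym.
have : 1 <= A i i * invmx A i i by rewrite -[X in X <= _]E gerDl.
rewrite ltNge => h; apply/negP => aii.
by have := le_trans h (mulr_le0_ge0 aii (K0 i i)); rewrite ler10.
Qed.

Lemma diag_part_unit : diag_part A \in unitmx.
Proof.
rewrite unitmxE det_diag unitfE; apply/prodf_neq0 => i _.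
by rewrite mxE gt_eqF // M_matrix_diag_gt0.
Qed.

Lemma AbarE : Abar A = 1%:M - Bbar A.
Proof.
by rewrite /Abar /Bbar /offdiag_part mulmxBr mulVmx ?diag_part_unit // opprB addrC subrK.
Qed.

Lemma Bbar_ge0 i j : 0 <= Bbar A i j.
Proof.
have [A0 uA K0] := hA.
suff -> : Bbar A i j = (A i i)^-1 * offdiag_part A i j.
  rewrite mulr_ge0 ?invr_ge0 ?(ltW (M_matrix_diag_gt0 _)) // !mxE.
  by rewrite mulrb; have [->|ij] := eqVneq i j; rewrite /= ?subrr // sub0r oppr_ge0 A0.
have E : offdiag_part A = diag_part A *m Bbar A by rewrite mulKVmx ?diag_part_unit.
rewrite E; move: (Bbar A) => C; rewrite /diag_part mul_diag_mx !mxE mulKf //.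
by rewrite gt_eqF // M_matrix_diag_gt0.
Qed.

Lemma inv_Abar_ge0 i j : 0 <= (invmx A *m diag_part A) i j.
Proof.
have [A0 uA K0] := hA.
by rewrite mul_mx_diag !mxE mulr_ge0 // ltW // M_matrix_diag_gt0.
Qed.

Lemma Abar_inv : (1%:M - Bbar A) *m (invmx A *m diag_part A) = 1%:M.
Proof.
have [A0 uA K0] := hA.
by rewrite -AbarE /Abar -mulmxA mulKVmx // mulVmx // diag_part_unit.
Qed.

(** Factoring out the diagonal, A + m D_A = D_A (m + 1) (1 - Bbar / (m + 1)). *)
Lemma det_permanental (m : nat) :
  \det (1%:M + invmx A *m diag_mx (\row_i (m%:R * A i i))) =
  (\det (Abar A))^-1 * m.+1%:R ^+ n * \det (1%:M - m.+1%:R^-1 *: Bbar A).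
Proof.
have [A0 uA K0] := hA.
have c0 : m.+1%:R != 0 :> R by rewrite pnatr_eq0.
have uD := diag_part_unit.
have -> : 1%:M + invmx A *m diag_mx (\row_i (m%:R * A i i)) =
   invmx A *m (diag_part A *m (m.+1%:R *: (1%:M - m.+1%:R^-1 *: Bbar A))).
  have -> : diag_mx (\row_i (m%:R * A i i)) = m%:R *: diag_part A.
    by apply/matrixP => i j; rewrite !mxE mulrnAr.
  rewrite scalerBr scalerA divff // scale1r mulmxBr scalemx1 mul_mx_scalar.
  have -> : diag_part A *m Bbar A = diag_part A - A by rewrite mulKVmx.
  rewrite -natr1 scalerDl scale1r opprB -addrA (addrCA (diag_part A) A).
  by rewrite subrr addr0 mulmxDr mulVmx // addrC.
rewrite /Abar !det_mulmx detZ !det_inv.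
have dA : \det A != 0 by rewrite -unitfE -unitmxE.
have dD : \det (diag_part A) != 0 by rewrite -unitfE -unitmxE.
by field; rewrite dA dD.
Qed.

End DiagonalScaling.

(** * The law of the total count *)

Section Counts.
Context (R : realType) (n : nat) (alpha : R) (A : 'M[R]_n).
Context (d : measure_display) (T : measurableType d) (P : probability T R).
Context (Z : 'I_n -> {RV P >-> nat}) (hZ : Z_law alpha A Z).
Let N w := (\sum_(i < n) Z i w)%N.

Let mZ (k : 'I_n -> nat) : measurable [set w | forall i, Z i w = k i].
Proof.
rewrite (_ : [set w | _] = \bigcap_(i in [set: 'I_n]) (Z i @^-1` [set k i])).
  apply: fin_bigcap_measurable; first exact: finite_finset.
  by move=> i _; rewrite -[_ @^-1` _]setTI; exact: measurable_funP.
by apply/seteqP; split => [w /= H i _|w /= H i]; exact: H.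
Qed.

Let K j : set {ffun 'I_n -> 'I_j.+1} :=
  [set` [pred k : {ffun 'I_n -> 'I_j.+1} | (\sum_(i < n) k i)%N == j]].

(** Finitely many vectors k have sum j, since each entry is at most j. *)
Let levelE j : [set w | N w = j] =
  \bigcup_(k in @K j) [set w | forall i, Z i w = k i].
Proof.
apply/seteqP; split => [w /= Nw|w [k /eqP Kk Zk]]; last first.
  by rewrite /= -[RHS]Kk; apply: eq_bigr => i _; rewrite Zk.
have Zj i : (Z i w < j.+1)%N by rewrite ltnS -Nw /N (bigD1 i) //= leq_addr.
exists [ffun i => inord (Z i w)] => /=.
  by apply/eqP; rewrite -[RHS]Nw; apply: eq_bigr => i _; rewrite ffunE inordK.
by move=> i; rewrite ffunE inordK.
Qed.

Lemma measurable_total_count j : measurable [set w | N w = j].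
Proof.
by rewrite levelE; apply: fin_bigcup_measurable => // ; exact: finite_finset.
Qed.

Lemma total_count_law j :
  P [set w | N w = j] = (\det (Abar A) `^ alpha * words_coef alpha (Bbar A) j)%:E.
Proof.
rewrite levelE measure_fin_bigcup //; last 2 first.
- exact: finite_finset.
- apply/trivIsetP => k l _ _ /eqP kl; apply/seteqP; split => // w [/= Zk Zl].
  by apply: kl; apply/ffunP => i; apply/val_inj; rewrite /= -Zk -Zl.
rewrite -(sum_blowup alpha) mulr_sumr -sumEFin.
rewrite -(bigfs _ (index_enum_uniq _)) /=; last by move=> k _; rewrite mem_index_enum.
by apply: eq_bigr => k _; rewrite (hZ (fun i => k i)) mulrA.
Qed.

End Counts.

(** * The two Laplace transforms *)

Section WeightedSum.
Context (R : realType) (n : nat) (alpha : R) (alpha_gt0 : 0 < alpha) (A : 'M[R]_n).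
Hypothesis hA : nonsingular_M_matrix A.
Local Notation c := (words_coef alpha (Bbar A)).
Local Notation gam := (\det (Abar A) `^ alpha).

Lemma det_Abar_gt0 : 0 < \det (Abar A).
Proof.
have := rev_charpoly_gt0 (Bbar_ge0 hA) (inv_Abar_ge0 hA) (Abar_inv hA).
by move=> /(_ 1); rewrite rev_charpolyE scale1r -AbarE //; apply; rewrite ler01 lexx.
Qed.

Section CountLaw.
Context (d : measure_display) (T : measurableType d) (P : probability T R).
Context (Z : 'I_n -> {RV P >-> nat}) (hZ : Z_law alpha A Z).
Local Notation N := (fun w => \sum_(i < n) Z i w)%N.

(** The level sets of the total count carry the whole mass 1. *)
Lemma cvg_words_coef_mass :
  (fun M => \sum_(j < M.+1) c j) @ \oo --> (\det (1%:M - Bbar A)) `^ (- alpha).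
Proof.
have gam0 : gam != 0 by rewrite gt_eqF // powR_gt0 // det_Abar_gt0.
have : (fun M => (\sum_(0 <= j < M) P [set w | N w = j])%E) @ \oo --> 1%E.
  rewrite -(probability_setT P) -(bigcup_level_sets N).
  apply: measure_sigma_additive; last exact: trivIset_level_sets.
  exact: measurable_total_count.
have -> : (fun M => (\sum_(0 <= j < M) P [set w | N w = j])%E) =
    EFin \o (fun M => gam * \sum_(j < M) c j).
  apply/funext => M /=; rewrite big_mkord mulr_sumr -sumEFin.
  by apply: eq_bigr => j _; rewrite (total_count_law hZ).
move/fine_cvgP => [_]; rewrite -cvg_shiftS => cv.
rewrite -AbarE // powRN -[_^-1]mulr1.
have -> : (fun M => \sum_(j < M.+1) c j) = (fun M => gam^-1 * (gam * \sum_(j < M.+1) c j)).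
  by apply/funext => M; rewrite mulKf.
by apply: cvgMr; exact: cv.
Qed.

Lemma laplace_total_count (m : nat) :
  (\sum_(j <oo) P [set w | N w = j] * (m.+1%:R `^ (- (n%:R * alpha + j%:R)))%:E
   = (\det (1%:M + invmx A *m diag_mx (\row_i (m%:R * A i i))) `^ (- alpha))%:E)%E.
Proof.
have K0 : (0 : R) < m.+1%:R by rewrite ltr0n.
set t : R := m.+1%:R^-1.
have t01 : 0 <= t <= 1 by rewrite invr_ge0 ltW // invf_le1 // ler1n.
have cv := words_series (Bbar_ge0 hA) (inv_Abar_ge0 hA) (Abar_inv hA) alpha_gt0
  cvg_words_coef_mass t01.
have q0 : 0 < \det (1%:M - t *: Bbar A).
  rewrite -rev_charpolyE.
  exact: (rev_charpoly_gt0 (Bbar_ge0 hA) (inv_Abar_ge0 hA) (Abar_inv hA)).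
pose C : R := gam * m.+1%:R `^ (- (n%:R * alpha)).
have -> : \det (1%:M + invmx A *m diag_mx (\row_i (m%:R * A i i))) `^ (- alpha) =
   C * \det (1%:M - t *: Bbar A) `^ (- alpha).
  rewrite det_permanental // -/t.
  rewrite powRM ?(ltW q0) // ?mulr_ge0 ?invr_ge0 ?exprn_ge0 ?(ltW det_Abar_gt0) //.
  rewrite powRM ?invr_ge0 ?exprn_ge0 ?(ltW det_Abar_gt0) // /C; congr (_ * _ * _).
    by rewrite -(powR_inv1 (ltW det_Abar_gt0)) -powRrM mulrNN mul1r.
  by rewrite -powR_mulrn // -powRrM mulrN.
apply/cvg_lim => //.
have -> : (fun M => (\sum_(0 <= j < M) P [set w | N w = j] *
     (m.+1%:R `^ (- (n%:R * alpha + j%:R)))%:E)%E) =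
    EFin \o (fun M => C * \sum_(j < M) c j * t ^+ j).
  apply/funext => M /=; rewrite big_mkord mulr_sumr -sumEFin.
  apply: eq_bigr => j _; rewrite (total_count_law hZ) -EFinM /C.
  rewrite opprD powRD ?(gt_eqF K0) ?implybT // powR_invn // exprVn; congr EFin; ring.
apply/cvg_EFin; first exact: nearW.
rewrite -cvg_shiftS; apply: cvgMr; exact: cv.
Qed.

End CountLaw.

Section PermanentalSum.
Context (d : measure_display) (T : measurableType d) (P : probability T R).
Context (X : 'I_n -> {RV P >-> R}) (hX : permanental alpha (invmx A) X).
Local Notation V := (fun w => l1norm (fun i => A i i * X i w)).

Lemma measurable_weighted_sum : measurable_fun [set: T] V.
Proof.
apply: measurable_sum => i; apply: measurableT_comp => //; exact: measurable_funM.
Qed.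

Lemma laplace_weighted_sum (m : nat) :
  (\int[P]_w (expR (- V w) ^+ m)%:E =
   (\det (1%:M + invmx A *m diag_mx (\row_i (m%:R * A i i))) `^ (- alpha))%:E)%E.
Proof.
have [X0 /(_ (fun i => m%:R * A i i))] := hX.
have a0 i := M_matrix_diag_gt0 hA i.
move=> <-; last by move=> i; rewrite mulr_ge0 // ltW.
rewrite unlock; apply: ae_eq_integral => //.
- by apply/measurable_EFinP/measurable_funX; apply: measurableT_comp => //;
    apply: measurableT_comp => //; exact: measurable_weighted_sum.
- apply/measurable_EFinP; apply: measurableT_comp => //; apply: measurableT_comp => //.
  by apply: measurable_sum => i; exact: measurable_funM.
- have aeX : \forall w \ae P, forall i, 0 <= X i w
    by apply: filter_forall => i; exact: X0.
  apply: filterS aeX => w Xw _ /=; congr EFin.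
  rewrite -expRM_natl mulrN; congr (expR (- _)).
  rewrite /l1norm mulr_sumr; apply: eq_bigr => i _.
  by rewrite ger0_norm ?mulrA // mulr_ge0 // ltW.
Qed.

End PermanentalSum.
End WeightedSum.

Theorem lemma2p1 (R : realType) (n : nat) (hn : (0 < n)%N)
    (alpha : R) (halpha : 0 < alpha)
    (A : 'M[R]_n) (hA : nonsingular_M_matrix A)
    (d : measure_display) (T : measurableType d) (P : probability T R)
    (X : 'I_n -> {RV P >-> R}) (hX : permanental alpha (invmx A) X)
    (d' : measure_display) (T' : measurableType d') (P' : probability T' R)
    (Z : 'I_n -> {RV P' >-> nat}) (hZ : Z_law alpha A Z)
    (xi : {RV P' >-> R})
    (hxi : gamma_mixture (n%:R * alpha) (fun w => \sum_(i < n) Z i w)%N xi)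
    (Phi : R -> R) (mPhi : measurable_fun [set: R] Phi)
    (Phi_ge0 : forall x, 0 <= Phi x) :
  ('E_P[fun w => Phi (l1norm (fun i => A i i * X i w)%R)] =
   'E_P'[fun w => Phi (xi w)])%E.
Proof.
have mV := measurable_weighted_sum A X.
pose lawV := borel_law P mV.
pose lawxi := borel_law P' (measurable_funPT xi).
have same_law : forall S, measurable S -> lawV S = lawxi S.
  apply: laplace_unique.
  - rewrite -(measure0 P); congr (P _); apply/seteqP; split => // w /=.
    by rewrite in_itv /= ltNge sumr_ge0.
  - exact: (gamma_mixture_lt0 (measurable_total_count Z) hxi).
  - move=> m; rewrite (laplace_gamma_mixture (measurable_total_count Z) hxi).
    rewrite (laplace_total_count halpha hA hZ) ge0_integral_borel_law; first last.
    + by move=> x; rewrite exprn_ge0 // expR_ge0.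
    + by apply: measurable_funX; apply: measurableT_comp.
    exact: laplace_weighted_sum.
rewrite unlock -(ge0_integral_borel_law P mV mPhi Phi_ge0).
rewrite -(ge0_integral_borel_law P' (measurable_funPT xi) mPhi Phi_ge0).
by apply: eq_measure_integral => S mS _; exact: same_law.
Qed.
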